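(* For each $G \in \widetilde{\mathbb{G}}$, the following hold: 1. $\lambda_t(G)$, $\rho_t(G)$, $G_t$ (for all $t\in\mathbb{Z}[\frac12]$) and $t(G)$ are well-defined by the recursion given in the context (that is, whenever the game under consideration is not equal to an integer, the maximum, the minimum, and the least element $\min\{t\in\mathbb{Z}[\frac12] \mid \widetilde{\lambda}_t=\widetilde{\rho}_t\}$ occurring in the recursion exist), and $t(G)>-1$ if $G$ is not equal to an integer. 2. $t\mapsto\lambda_t(G)$ is a diadic trajectory consisting of segments with slope $0$ or $-1$. 3. $t\mapsto\rho_t(G)$ is a diadic trajectory consisting of segments with slope $0$ or $1$. 4. Both $\lambda_t(G)$ and $\rho_t(G)$ (as functions of $t$) have masts, and their mast values are equal. 5. For all $t \in \mathbb{Z}[\frac12]$, $L(G_t)=\lambda_t(G)$ and $R(G_t)=\rho_t(G)$. 6. Suppose $G$ is not equal to an integer. Then, for each $t\in\mathbb{Z}[\frac12]$ with $t>-1$: (a) if $t<t(G)$, then $G_t$ is not numberish; (b) if $t=t(G)$, then $G_t$ is numberish; (c) if $t>t(G)$, then $G_t$ is equal to a number.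
   Context: Games. $\widetilde{\mathbb{G}}$ is the set of all formal (short, i.e. finite loopfree) normal-play partizan games $G=\{G^L\mid G^R\}$, where $G^L$ (resp. $G^R$) ranges over the finitely many Left (resp. Right) options of $G$; $\tilde b(G)$ is the formal birthday (height of the game tree). Sums and negatives of games are the usual ones; $G\ge 0$ means Left wins $G$ moving second under normal play, $G\ge H$ means $G-H\ge 0$, and $G$ is equal to $H$ (equality of game values) if $G\ge H$ and $H\ge G$. $\mathbb{G}$ is the group of game values. The dyadic rationals $\mathbb{Z}[\frac12]$ are identified in the usual way with the subgroup of numbers in $\mathbb{G}$; ''equal to an integer/number'' means having such a game value. When a dyadic rational is used as a formal game, its canonical form is meant. Stops. $L(G)=R(G)=x$ if $G$ is equal to a number $x$; otherwise $L(G)=\max_{G^L}R(G^L)$ and $R(G)=\min_{G^R}L(G^R)$. $G$ is numberish if it is infinitesimally close to some number $x$, i.e. $-\varepsilon<G-x<\varepsilon$ for every positive number $\varepsilon$. Cooling and temperature. For $G\in\widetilde{\mathbb{G}}$ and $t\in\mathbb{Z}[\frac12]$, define $\lambda_t(G),\rho_t(G)\in\mathbb{Z}[\frac12]$, $G_t\in\widetilde{\mathbb{G}}$ and $t(G)\in\mathbb{Z}[\frac12]\cup\{-\infty\}$ by recursion on $\tilde b(G)$: - If $G$ is equal to an integer $n$: $\lambda_t(G)=\rho_t(G)=n$, $G_t=n$ (canonical form), $t(G)=-\infty$. - Otherwise let $\widetilde{\lambda}_t(G)=\max_{G^L}\{\rho_t(G^L)-t\}$, $\widetilde{\rho}_t(G)=\min_{G^R}\{\lambda_t(G^R)+t\}$,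 $\widetilde{G}_t=\{(G^L)_t-t\mid (G^R)_t+t\}$ (with all $G^L$, $G^R$), and $t(G)=\min\{t\in\mathbb{Z}[\frac12]\mid \widetilde{\lambda}_t(G)=\widetilde{\rho}_t(G)\}$. If $t\le t(G)$, set $\lambda_t(G)=\widetilde{\lambda}_t(G)$, $\rho_t(G)=\widetilde{\rho}_t(G)$, $G_t=\widetilde{G}_t$. If $t>t(G)$, set $\lambda_t(G)=\rho_t(G)=x$ and $G_t=x$ (canonical form), where $x=\lambda_{t(G)}(G)=\rho_{t(G)}(G)$. Diadic trajectories. A diadic trajectory is a function $f:\mathbb{Z}[\frac12]\to\mathbb{Z}[\frac12]$ of the form $f(x)=a_0x+b_0$ for $x\le j_0$, $f(x)=a_ix+b_i$ for $j_{i-1}\le x\le j_i$ ($i=1,\dots,n$), $f(x)=a_{n+1}x+b_{n+1}$ for $x\ge j_n$, where $n\ge 0$, $j_0,\dots,j_n\in\mathbb{Z}[\frac12]$, all $b_i\in\mathbb{Z}[\frac12]$, all $a_i\in\{-1,0,1\}$, and $a_ij_i+b_i=a_{i+1}j_i+b_{i+1}$ for $0\le i\le n$ (the pieces, including the two half lines, join up). It consists of segments with slopes in a set $A$ if it can be written so with all $a_i\in A$. If $a_{n+1}=0$, the last half line is called its mast, and $b_{n+1}$ its mast value. *)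

(* Defs.v *)
From HB Require Import structures.
From mathcomp Require Import all_boot all_order all_algebra.
From mathcomp Require Import boolp classical_sets.
From mathcomp Require Import ring.

Set Implicit Arguments.
Unset Strict Implicit.
Unset Printing Implicit Defensive.

Import Order.TTheory GRing.Theory Num.Theory.
Local Open Scope classical_set_scope.
Local Open Scope ring_scope.

(* The ring Z[1/2], as a subring of rat with the induced order. *)

Definition is_dyadic : pred rat :=
  fun x => `[< exists (m : int) (k : nat), x = m%:~R / 2 ^+ k >].

Fact is_dyadic_subring : subring_closed is_dyadic.
Proof.
have nz k : (2 : rat) ^+ k != 0 by rewrite expf_neq0.
split.
- by apply/asboolP; exists 1, 0%N; rewrite expr0 divr1.
- move=> _ _ /asboolP[m [k ->]] /asboolP[n [l ->]]; apply/asboolP.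
  exists (m * 2 ^+ l - n * 2 ^+ k), (k + l)%N.
  rewrite rmorphB !rmorphM !rmorphXn /= exprD.
  by field; rewrite !nz.
- move=> _ _ /asboolP[m [k ->]] /asboolP[n [l ->]]; apply/asboolP.
  exists (m * n), (k + l)%N; rewrite rmorphM /= exprD.
  by field; rewrite !nz.
Qed.

HB.instance Definition _ :=
  GRing.isSubringClosed.Build rat is_dyadic is_dyadic_subring.

Record dyadic : Type := Dyadic { dyval :> rat; _ : is_dyadic dyval }.

HB.instance Definition _ := [isSub for dyval].
HB.instance Definition _ := [Choice of dyadic by <:].
HB.instance Definition _ := [SubChoice_isSubComNzRing of dyadic by <:].

Fact dyadic_unit_mulV :
  {in [pred x : dyadic | `[< exists y, y * x = 1 >]],
    left_inverse 1 (fun x => if pselect (exists y : dyadic, y * x = 1) is left h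
                             then projT1 (cid h) else x) *%R}.
Proof.
move=> x /asboolP h; case: pselect => // h'; exact: (projT2 (cid h')).
Qed.

Fact dyadic_unitP (x y : dyadic) :
  y * x = 1 -> [pred x : dyadic | `[< exists y, y * x = 1 >]] x.
Proof. by move=> yx; apply/asboolP; exists y. Qed.

Fact dyadic_invr_out :
  {in [predC [pred x : dyadic | `[< exists y, y * x = 1 >]]],
    (fun x => if pselect (exists y : dyadic, y * x = 1) is left h
              then projT1 (cid h) else x) =1 id}.
Proof. by move=> x /asboolP nh; case: pselect. Qed.

HB.instance Definition _ := GRing.ComNzRing_hasMulInverse.Build dyadic
  dyadic_unit_mulV dyadic_unitP dyadic_invr_out.

Fact dyadic_idomain (x y : dyadic) : x * y = 0 -> (x == 0) || (y == 0).
Proof.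
by move=> /(congr1 val)/eqP; rewrite rmorphM /= mulf_eq0.
Qed.

HB.instance Definition _ :=
  GRing.ComUnitRing_isIntegral.Build dyadic dyadic_idomain.

Definition dyle (x y : dyadic) := dyval x <= dyval y.
Definition dylt (x y : dyadic) := dyval x < dyval y.
Definition dynorm (x : dyadic) := if dyle 0 x then x else - x.

Fact dyle0_add x y : dyle 0 x -> dyle 0 y -> dyle 0 (x + y).
Proof. exact: addr_ge0. Qed.
Fact dyle0_mul x y : dyle 0 x -> dyle 0 y -> dyle 0 (x * y).
Proof. exact: mulr_ge0. Qed.
Fact dyle0_anti x : dyle 0 x -> dyle x 0 -> x = 0.
Proof. by move=> h1 h2; apply/val_inj/le_anti/andP. Qed.
Fact dysub_ge0 x y : dyle 0 (y - x) = dyle x y.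
Proof. exact: subr_ge0. Qed.
Fact dyle0_total x : dyle 0 x || dyle x 0.
Proof. exact: le_total. Qed.
Fact dyge0_norm x : dyle 0 x -> dynorm x = x.
Proof. by rewrite /dynorm => ->. Qed.
Fact dynormN x : dynorm (- x) = dynorm x.
Proof.
have e : dyle 0 (- x) = dyle x 0 by rewrite -(dysub_ge0 x 0) sub0r.
rewrite /dynorm e opprK.
case: ifP => h1; case: ifP => h2 //; last first.
  by move: (dyle0_total x); rewrite h1 h2.
by rewrite (dyle0_anti h2 h1) oppr0.
Qed.
Fact dylt_def x y : dylt x y = (y != x) && dyle x y.
Proof. by rewrite /dylt lt_def. Qed.

HB.instance Definition _ := Num.IntegralDomain_isLeReal.Build dyadic
  dyle0_add dyle0_mul dyle0_anti dysub_ge0 dyle0_total dynormN dyge0_norm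
  dylt_def.

Definition is_max (A : set dyadic) (x : dyadic) := A x /\ ubound A x.
Definition is_min (A : set dyadic) (x : dyadic) := A x /\ lbound A x.

(* The junk value 0 is taken when there is no maximum (resp. minimum). *)
Definition maxd (A : set dyadic) : dyadic := xget 0 (is_max A).
Definition mind (A : set dyadic) : dyadic := xget 0 (is_min A).

(* Short games; order and repetition of the listed options are immaterial. *)
Inductive game : Type := Game of seq game & seq game.

Definition lefts (G : game) : seq game := let: Game Ls _ := G in Ls.
Definition rights (G : game) : seq game := let: Game _ Rs := G in Rs.

(* [Lwins true G]: Left wins G moving first; [Lwins false G]: Left wins G
   moving second. *)
Fixpoint Lwins (first : bool) (G : game) : bool :=
  let: Game Ls Rs := G in
  if first then has (Lwins false) Ls else all (Lwins true) Rs.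

Fixpoint game_opp (G : game) : game :=
  let: Game Ls Rs := G in Game (map game_opp Rs) (map game_opp Ls).

Fixpoint game_add (G : game) : game -> game :=
  let: Game GLs GRs := G in
  fix addG (H : game) : game :=
    let: Game HLs HRs := H in
    Game ([seq game_add GL H | GL <- GLs] ++ [seq addG HL | HL <- HLs])
         ([seq game_add GR H | GR <- GRs] ++ [seq addG HR | HR <- HRs]).

Definition game_sub (G H : game) : game := game_add G (game_opp H).

Definition game_ge (G H : game) : bool := Lwins false (game_sub G H).
Definition game_gt (G H : game) : bool := game_ge G H && ~~ game_ge H G.
Definition game_eq (G H : game) : bool := game_ge G H && game_ge H G.

(* Canonical forms: n + 1 = {n | }, - n - 1 = { | - n}, and
   m / 2^k = {(m - 1) / 2^k | (m + 1) / 2^k} for m odd and k > 0. *)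
Fixpoint canon_nat (n : nat) : game :=
  if n is n'.+1 then Game [:: canon_nat n'] [::] else Game [::] [::].

Definition canon_int (m : int) : game :=
  match m with Posz n => canon_nat n | Negz n => game_opp (canon_nat n.+1) end.

(* The canonical form of m / 2^k, the fraction being reduced or not. *)
Fixpoint canon_frac (k : nat) (m : int) : game :=
  if k is k'.+1 then
    if (2 %| m)%Z then canon_frac k' (m %/ 2)%Z
    else Game [:: canon_frac k' ((m - 1) %/ 2)%Z]
              [:: canon_frac k' ((m + 1) %/ 2)%Z]
  else canon_int m.

(* In lowest terms the denominator of x is 2 ^ logn 2 (denq x). *)
Definition canon (x : dyadic) : game :=
  canon_frac (logn 2 `|denq (dyval x)|%N) (numq (dyval x)).

Definition equal_to_integer (G : game) : Prop :=
  exists n : int, game_eq G (canon n%:~R).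

Definition equal_to_number (G : game) : Prop :=
  exists x : dyadic, game_eq G (canon x).

Definition numberish (G : game) : Prop :=
  exists x : dyadic, forall e : dyadic, 0 < e ->
    game_gt (game_sub G (canon x)) (game_opp (canon e)) /\
    game_gt (canon e) (game_sub G (canon x)).

(* [stop true] is the Left stop and [stop false] the Right stop. *)
Fixpoint stop (left : bool) (G : game) : dyadic :=
  let: Game Ls Rs := G in
  if pselect (equal_to_number G) is left h then projT1 (cid h)
  else if left then maxd [set` [seq stop false GL | GL <- Ls]]
  else mind [set` [seq stop true GR | GR <- Rs]].

Definition Lstop (G : game) : dyadic := stop true G.
Definition Rstop (G : game) : dyadic := stop false G.

(* The four quantities lambda_t(G), rho_t(G), G_t, t(G) attached to a game by
   the recursion; the temperature [None] stands for - oo. *)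
Record thermo_data : Type := ThermoData {
  td_lambda : dyadic -> dyadic;
  td_rho : dyadic -> dyadic;
  td_cool : dyadic -> game;
  td_temp : option dyadic }.

Definition left_scores (dl : seq thermo_data) (t : dyadic) : set dyadic :=
  [set` [seq td_rho d t - t | d <- dl]].
Definition right_scores (dr : seq thermo_data) (t : dyadic) : set dyadic :=
  [set` [seq td_lambda d t + t | d <- dr]].

Definition thermo_int (n : int) : thermo_data :=
  {| td_lambda := fun=> n%:~R;
     td_rho := fun=> n%:~R;
     td_cool := fun=> canon n%:~R;
     td_temp := None |}.

(* The recursion for a game not equal to an integer, from the data [dl] of its
   Left options and [dr] of its Right options. *)
Definition thermo_step (dl dr : seq thermo_data) : thermo_data :=
  let lamt t := maxd (left_scores dl t) in
  let rhot t := mind (right_scores dr t) in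
  let coolt t := Game [seq game_sub (td_cool d t) (canon t) | d <- dl]
                      [seq game_add (td_cool d t) (canon t) | d <- dr] in
  let tau := mind [set t | lamt t = rhot t] in
  let x := lamt tau in
  {| td_lambda := fun t => if t <= tau then lamt t else x;
     td_rho := fun t => if t <= tau then rhot t else x;
     td_cool := fun t => if t <= tau then coolt t else canon x;
     td_temp := Some tau |}.

Fixpoint thermo (G : game) : thermo_data :=
  let: Game Ls Rs := G in
  if pselect (equal_to_integer G) is left h then thermo_int (projT1 (cid h))
  else thermo_step (map thermo Ls) (map thermo Rs).

Definition lambda (t : dyadic) (G : game) : dyadic := td_lambda (thermo G) t.
Definition rho (t : dyadic) (G : game) : dyadic := td_rho (thermo G) t.
Definition cooled (t : dyadic) (G : game) : game := td_cool (thermo G) t.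
Definition temp (G : game) : option dyadic := td_temp (thermo G).

Definition lambda_tilde_set (t : dyadic) (G : game) : set dyadic :=
  [set` [seq rho t GL - t | GL <- lefts G]].
Definition rho_tilde_set (t : dyadic) (G : game) : set dyadic :=
  [set` [seq lambda t GR + t | GR <- rights G]].
Definition lambda_tilde (t : dyadic) (G : game) : dyadic :=
  maxd (lambda_tilde_set t G).
Definition rho_tilde (t : dyadic) (G : game) : dyadic :=
  mind (rho_tilde_set t G).
Definition cooled_tilde (t : dyadic) (G : game) : game :=
  Game [seq game_sub (cooled t GL) (canon t) | GL <- lefts G]
       [seq game_add (cooled t GR) (canon t) | GR <- rights G].
Definition balance_set (G : game) : set dyadic :=
  [set t | lambda_tilde t G = rho_tilde t G].

Lemma thermo_nonintE (G : game) : ~ equal_to_integer G ->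
  let tau := mind (balance_set G) in
  let x := lambda_tilde tau G in
  [/\ temp G = Some tau,
      forall t, lambda t G = if t <= tau then lambda_tilde t G else x,
      forall t, rho t G = if t <= tau then rho_tilde t G else x &
      forall t, cooled t G = if t <= tau then cooled_tilde t G else canon x].
Proof.
case: G => Ls Rs nG /=.
have e1 u : lambda_tilde_set u (Game Ls Rs) = left_scores (map thermo Ls) u.
  by rewrite /lambda_tilde_set /left_scores -map_comp.
have e2 u : rho_tilde_set u (Game Ls Rs) = right_scores (map thermo Rs) u.
  by rewrite /rho_tilde_set /right_scores -map_comp.
have e3 : balance_set (Game Ls Rs) =
    [set t | maxd (left_scores (map thermo Ls) t)
             = mind (right_scores (map thermo Rs) t)].
  by apply/funext => t; rewrite /balance_set /lambda_tilde /rho_tilde /= e1 e2.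
rewrite /temp /lambda /rho /cooled /lambda_tilde /rho_tilde /cooled_tilde.
rewrite e3 /=; case: pselect => [h|_] /=; first by case: nG.
by split=> // t; rewrite ?e1 ?e2 // -!map_comp.
Qed.

(* [f] is the continuous piecewise affine function with break points
   j 0 <= ... <= j n and pieces a i * x + b i for i = 0, ..., n + 1; the values
   of a, b, j at larger indices are irrelevant. *)
Definition trajectory_form (f : dyadic -> dyadic) (n : nat)
    (a b j : nat -> dyadic) : Prop :=
  [/\ forall i, (i <= n.+1)%N -> a i \in [:: -1; 0; 1],
      forall i, (i < n)%N -> j i <= j i.+1,
      forall i, (i <= n)%N -> a i * j i + b i = a i.+1 * j i + b i.+1 &
      [/\ forall x, x <= j 0%N -> f x = a 0%N * x + b 0%N,
          forall i x, (i < n)%N -> j i <= x <= j i.+1 ->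
            f x = a i.+1 * x + b i.+1 &
          forall x, j n <= x -> f x = a n.+1 * x + b n.+1]].

Definition diadic_trajectory (f : dyadic -> dyadic) : Prop :=
  exists n a b j, trajectory_form f n a b j.

Definition diadic_trajectory_slopes (A : seq dyadic) (f : dyadic -> dyadic) :
    Prop :=
  exists n a b j, trajectory_form f n a b j /\
    forall i, (i <= n.+1)%N -> a i \in A.

Definition mast_value (f : dyadic -> dyadic) (c : dyadic) : Prop :=
  exists n a b j,
    [/\ trajectory_form f n a b j, a n.+1 = 0 & b n.+1 = c].

(* Main.v *)
(* Numbers enter only through comparisons: L(G) and R(G) are determined by
   which dyadic rationals lie above or below G, which makes stops invariant
   under translation by numbers.  The comparisons themselves rest on number
   avoidance: if G is not a number and x is, then whenever Left wins G - x
   moving first she can do so by moving in G.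

   The walls lambda_t(G), rho_t(G) are built from those of the options by
   finite maxima and minima, by adding the functions -t and t, and by a
   truncation at the temperature, operations which preserve piecewise affine
   functions with slopes in {0,-1} resp. {0,1}.  The difference of the two
   untruncated walls has slopes in {0,-1,-2}, so its least zero exists and is
   dyadic as soon as it is positive somewhere and nonpositive somewhere.  It is
   nonpositive for large t because the walls of the options are bounded, and
   positive at t = -1 because otherwise an integer m would satisfy
   G^L <| m <| G^R for all options, so that G would be an integer. *)

From HB Require Import structures.
From mathcomp Require Import all_boot all_order all_algebra.
From mathcomp Require Import boolp classical_sets.
From mathcomp Require Import ring lra zify.
Require Import Defs.
Import Order.TTheory GRing.Theory Num.Theory.
Local Open Scope ring_scope.

(** * The partial order of games *)

(** Equality of formal games is decided classically, so that [\in] makes sense for lists of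
    options. *)
HB.instance Definition _ := gen_eqMixin game.

(** The number of nodes of the game tree. Sums of sizes measure inductions on several games at once;
    the size also bounds a game by integers in [ge_canon_size]. *)
Fixpoint gsize (G : game) : nat :=
  let: Game Ls Rs := G in (sumn (map gsize Ls) + sumn (map gsize Rs)).+1.

Lemma gsize_left G GL : GL \in lefts G -> (gsize GL < gsize G)%N.
Proof.
case: G => Ls Rs /= GLin; rewrite ltnS; apply: leq_trans (leq_addr _ _).
elim: Ls GLin => //= X Ls IH; rewrite in_cons => /orP[/eqP->|/IH]; lia.
Qed.

Lemma gsize_right G GR : GR \in rights G -> (gsize GR < gsize G)%N.
Proof.
case: G => Ls Rs /= GRin; rewrite ltnS; apply: leq_trans (leq_addl _ _).
elim: Rs GRin => //= X Rs IH; rewrite in_cons => /orP[/eqP->|/IH]; lia.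
Qed.

(** The principle generated for [game] has no hypotheses on the entries of the nested lists; here
    they are available for every option. *)
Lemma game_opt_ind (P : game -> Prop) :
  (forall G, (forall GL, GL \in lefts G -> P GL) ->
     (forall GR, GR \in rights G -> P GR) -> P G) ->
  forall G, P G.
Proof.
move=> IH G; have [n] := ubnP (gsize G); elim: n G => // n IHn G ltG.
apply: IH => X /[dup] Xin.
- by move=> /gsize_left ltX; apply: IHn; apply: leq_trans ltX _.
- by move=> /gsize_right ltX; apply: IHn; apply: leq_trans ltX _.
Qed.

Lemma LwinsT G : Lwins true G = has (Lwins false) (lefts G).
Proof. by case: G. Qed.

Lemma LwinsF G : Lwins false G = all (Lwins true) (rights G).
Proof. by case: G. Qed.

Lemma lefts_opp G : lefts (game_opp G) = map game_opp (rights G).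
Proof. by case: G. Qed.

Lemma rights_opp G : rights (game_opp G) = map game_opp (lefts G).
Proof. by case: G. Qed.

Lemma lefts_add G H :
  lefts (game_add G H) = map (game_add^~ H) (lefts G) ++
                         map (game_add G) (lefts H).
Proof. by case: G H => [? ?] []. Qed.

Lemma rights_add G H :
  rights (game_add G H) = map (game_add^~ H) (rights G) ++
                          map (game_add G) (rights H).
Proof. by case: G H => [? ?] []. Qed.

Lemma left_addl {G GL} H : GL \in lefts G ->
  game_add GL H \in lefts (game_add G H).
Proof. by rewrite lefts_add mem_cat => /(map_f (game_add^~ H)) ->. Qed.

Lemma left_addr G {H HL} : HL \in lefts H ->
  game_add G HL \in lefts (game_add G H).
Proof. by rewrite lefts_add mem_cat orbC => /(map_f (game_add G)) ->. Qed.

Lemma right_addl {G GR} H : GR \in rights G ->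
  game_add GR H \in rights (game_add G H).
Proof. by rewrite rights_add mem_cat => /(map_f (game_add^~ H)) ->. Qed.

Lemma right_addr G {H HR} : HR \in rights H ->
  game_add G HR \in rights (game_add G H).
Proof. by rewrite rights_add mem_cat orbC => /(map_f (game_add G)) ->. Qed.

Lemma game_ext G H : lefts G = lefts H -> rights G = rights H -> G = H.
Proof. by case: G H => [? ?] [? ?] /= -> ->. Qed.

Lemma game_oppK : involutive game_opp.
Proof.
elim/game_opt_ind => G IHL IHR.
by apply: game_ext; rewrite ?(lefts_opp, rights_opp) -map_comp;
  apply: map_id_in.
Qed.

Lemma game_oppD G H :
  game_opp (game_add G H) = game_add (game_opp G) (game_opp H).
Proof.
elim/game_opt_ind: G H => G IHL IHR; elim/game_opt_ind => H JHL JHR.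
by apply: game_ext;
  rewrite ?(lefts_opp, rights_opp, lefts_add, rights_add) map_cat -!map_comp;
  congr (_ ++ _); apply/eq_in_map => X Xin /=; auto.
Qed.

Lemma game_addA G H K :
  game_add G (game_add H K) = game_add (game_add G H) K.
Proof.
elim/game_opt_ind: G H K => G IHL IHR; elim/game_opt_ind => H JHL JHR.
elim/game_opt_ind => K KHL KHR.
by apply: game_ext; rewrite !(lefts_add, rights_add) !map_cat -!map_comp -catA;
  congr (_ ++ _ ++ _); apply/eq_in_map => X Xin /=; auto.
Qed.

Lemma game_addG0 G : game_add G (Game [::] [::]) = G.
Proof.
elim/game_opt_ind: G => G IHL IHR.
by apply: game_ext; rewrite ?(lefts_add, rights_add) cats0; apply: map_id_in.
Qed.

(** Swapping the summands permutes the lists of options. Hence commutativity, unlike associativity,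
    is not an equality of formal games, but it holds for outcomes, which is all that the order
    sees. *)
Lemma Lwins_addC b G H : Lwins b (game_add G H) = Lwins b (game_add H G).
Proof.
elim/game_opt_ind: G b H => G IHL IHR b H; elim/game_opt_ind: H b => H JHL JHR.
case; rewrite ?(LwinsT, LwinsF, lefts_add, rights_add).
- rewrite !has_cat !has_map orbC; congr orb; apply: eq_in_has => X Xin.
  + exact: JHL.
  + exact: IHL.
- rewrite !all_cat !all_map andbC; congr andb; apply: eq_in_all => X Xin.
  + exact: JHR.
  + exact: IHR.
Qed.

Lemma Lwins_opp b G : Lwins b (game_opp G) = ~~ Lwins (~~ b) G.
Proof.
elim/game_opt_ind: G b => G IHL IHR [] /=.
- rewrite LwinsT LwinsF lefts_opp has_map -has_predC.
  by apply: eq_in_has => X Xin /=; rewrite IHR.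
- rewrite LwinsT LwinsF rights_opp all_map -all_predC.
  by apply: eq_in_all => X Xin /=; rewrite IHL.
Qed.

(** Up to commutativity [G - H] is the negative of [H - G], and negation exchanges the players. *)
Lemma LwinsT_sub G H : Lwins true (game_sub G H) = ~~ game_ge H G.
Proof.
rewrite /game_ge /game_sub Lwins_addC -[in LHS](game_oppK G) -game_oppD.
by rewrite Lwins_opp.
Qed.

(** Right moves from [G - H] either to a Right option of [G] or to the negative of a Left option of
    [H], and Left must then win moving first. This recursion replaces most later reasoning about
    play. *)
Lemma game_geE G H : game_ge G H =
  all (fun GR => ~~ game_ge H GR) (rights G) &&
  all (fun HL => ~~ game_ge HL G) (lefts H).
Proof.
rewrite {1}/game_ge LwinsF rights_add all_cat !all_map rights_opp all_map.
by congr (_ && _); apply: eq_all => X /=; rewrite -LwinsT_sub.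
Qed.

Lemma game_geP G H : reflect
  ((forall GR, GR \in rights G -> ~~ game_ge H GR) /\
   (forall HL, HL \in lefts H -> ~~ game_ge HL G)) (game_ge G H).
Proof.
by rewrite game_geE; apply: (iffP andP) => -[/allP h1 /allP h2]; split=> //;
  apply/allP.
Qed.

Lemma game_ge_opp G H : game_ge (game_opp G) (game_opp H) = game_ge H G.
Proof. by rewrite /game_ge /game_sub game_oppK Lwins_addC. Qed.

Lemma game_ge_oppl G H : game_ge (game_opp G) H = game_ge (game_opp H) G.
Proof. by rewrite -[in LHS](game_oppK H) game_ge_opp. Qed.

Lemma game_ge_oppr G H : game_ge G (game_opp H) = game_ge H (game_opp G).
Proof. by rewrite -[in LHS](game_oppK G) game_ge_opp. Qed.

Lemma game_ge_refl G : game_ge G G.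
Proof.
elim/game_opt_ind: G => G IHL IHR; apply/game_geP.
split=> X Xin; apply/negP => /game_geP[h1 h2].
- by have := h1 _ Xin; rewrite IHR.
- by have := h2 _ Xin; rewrite IHL.
Qed.

Lemma not_ge_right {G GR} : GR \in rights G -> ~~ game_ge G GR.
Proof. by have /game_geP[h _] := game_ge_refl G; exact: h. Qed.

Lemma not_left_ge {G GL} : GL \in lefts G -> ~~ game_ge GL G.
Proof. by have /game_geP[_ h] := game_ge_refl G; exact: h. Qed.

(** If [K >= X] for a Right option [X] of [G], then [H >= K >= X] contradicts [G >= H]; Left options
    of [K] are dual. The induction hypothesis is applied to a rotated triple, hence the induction on
    the total size. *)
Lemma game_ge_trans {G H K} : game_ge G H -> game_ge H K -> game_ge G K.
Proof.
have [n] := ubnP (gsize G + gsize H + gsize K).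
elim: n G H K => // n IH G H K ltn GH HK.
apply/game_geP; split=> X /[dup] Xin => [/gsize_right|/gsize_left] ltX.
- apply/negP => KX; have /game_geP[/(_ _ Xin)/negP h _] := GH.
  by apply: h; apply: IH HK KX; lia.
- apply/negP => XG; have /game_geP[_ /(_ _ Xin)/negP h] := HK.
  by apply: h; apply: IH XG GH; lia.
Qed.

Lemma game_ge_add2r G H K :
  game_ge (game_add G K) (game_add H K) = game_ge G H.
Proof.
have [n] := ubnP (gsize G + gsize H + gsize K).
elim: n G H K => // n IH G H K ltn.
apply/game_geP/idP => [[hR hL]|GH].
- apply/game_geP; split=> X /[dup] Xin => [/gsize_right|/gsize_left] ltX.
  + rewrite -(IH _ _ K); last by lia.
    exact: hR (right_addl K Xin).
  + rewrite -(IH _ _ K); last by lia.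
    exact: hL (left_addl K Xin).
- rewrite rights_add lefts_add; split=> X; rewrite mem_cat.
  + case/orP=> /mapP[Y /[dup] Yin /gsize_right ltY ->].
      by rewrite IH; [have /game_geP[h _] := GH; exact: h | lia].
    (* For a Right move from [K] to [Y]: [H + K >= G + Y >= H + Y] would put [H + K] above its own
       Right option. *)
    apply/negP => h; have /negP := not_ge_right (right_addr H Yin).
    by apply; apply: game_ge_trans h _; rewrite IH //; lia.
  + case/orP=> /mapP[Y /[dup] Yin /gsize_left ltY ->].
      by rewrite IH; [have /game_geP[_ h] := GH; exact: h | lia].
    apply/negP => h; have /negP := not_left_ge (left_addr G Yin).
    by apply; apply: game_ge_trans _ h; rewrite IH //; lia.
Qed.

(** * Canonical forms of dyadic rationals *)

(** Inversion is the identity on non-units, so [x / 2] and [2 ^- k] have their usual meaning only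
    because of this fact. *)
Lemma dyadic_two_unit : (2 : dyadic) \is a GRing.unit.
Proof.
have half : is_dyadic (1 / 2) by apply/asboolP; exists 1, 1%N; rewrite expr1.
apply/unitrP; exists (Dyadic half).
by split; apply: val_inj; rewrite rmorphM /=; field.
Qed.

Lemma dyadic_halfK (x : dyadic) : x / 2 + x / 2 = x.
Proof. by rewrite -mulr2n -[LHS]mulr_natr divrK ?dyadic_two_unit. Qed.

Lemma dyval_frac {x : dyadic} {k} {m : int} : x * 2 ^+ k = m%:~R ->
  dyval x = m%:~R / 2 ^+ k.
Proof.
move=> /(congr1 val); rewrite rmorphM rmorphXn rmorph_int /= => <-.
by rewrite mulfK // expf_neq0.
Qed.

Lemma dyadic_repr (x : dyadic) : exists k (m : int),
  x * 2 ^+ k = m%:~R /\ (k = 0%N \/ ~~ (2 %| m)%Z).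
Proof.
have [k [m xE]] : exists k (m : int), x * 2 ^+ k = m%:~R.
  have /asboolP[m [k xE]] := valP x; exists k, m; apply: val_inj.
  by rewrite rmorphM rmorphXn rmorph_int /= xE divfK // expf_neq0.
elim: k m xE => [|k IH] m xE; first by exists 0%N, m; split=> //; left.
have [/divzK mE|odd_m] := boolP (2 %| m)%Z; last by exists k.+1, m; auto.
apply: (IH (m %/ 2)%Z); apply: (mulIf (_ : (2 : dyadic) != 0)) => //.
by rewrite -mulrA -exprSr xE -{1}mE rmorphM.
Qed.

(** [canon] may be computed from any representation: [canon_frac] cancels even numerators by itself,
    and an odd numerator over a power of 2 is already in lowest terms. *)
Lemma canonE {x : dyadic} {k} {m : int} : x * 2 ^+ k = m%:~R ->
  canon x = canon_frac k m.
Proof.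
elim: k m => [|k IH] m xE.
  move: xE; rewrite /canon expr0 mulr1 => ->.
  by rewrite [dyval _](rmorph_int val) denq_int numq_int.
have [mdiv|odd_m] := boolP (2 %| m)%Z.
  rewrite /= mdiv; apply: IH; apply: (mulIf (_ : (2 : dyadic) != 0)) => //.
  by rewrite -mulrA -exprSr xE -{1}(divzK mdiv) rmorphM.
have cop : coprime `|m| `|(2 : int) ^+ k.+1|.
  by rewrite abszX coprimeXr // coprimen2; lia.
rewrite /canon (dyval_frac xE).
have -> : (2 : rat) ^+ k.+1 = ((2 : int) ^+ k.+1)%:~R by rewrite rmorphXn.
rewrite coprimeq_num // coprimeq_den // expf_eq0 /= gtr0_sg ?exprn_gt0 // mul1r.
by rewrite (_ : logn _ _ = k.+1) ?abszX ?pfactorK.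
Qed.

Lemma canon_nat_succ n : canon n.+1%:R = Game [:: canon n%:R] [::].
Proof.
have E k : canon k%:R = canon_nat k.
  by rewrite (@canonE _ 0 k%:Z) // expr0 mulr1 -pmulrn.
by rewrite !E.
Qed.

Lemma canon0 : canon 0 = Game [::] [::].
Proof. by rewrite (@canonE _ 0 0) // mul0r. Qed.

Lemma canon_odd {x : dyadic} {k} {m : int} :
  x * 2 ^+ k.+1 = m%:~R -> ~~ (2 %| m)%Z ->
  canon x = Game [:: canon (x - 2 ^- k.+1)] [:: canon (x + 2 ^- k.+1)].
Proof.
move=> xE odd_m; rewrite (canonE xE) /= (negbTE odd_m).
have u : (2 : dyadic) ^+ k.+1 \is a GRing.unit.
  by rewrite unitrX ?dyadic_two_unit.
(* Over [2 ^+ k.+1] the two neighbours have even numerators, which [canon_frac] halves. *)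
congr Game; congr [:: _]; symmetry.
- rewrite (@canonE _ k.+1 (m - 1)) /= ?mulrBl ?mulVr // ?xE ?rmorphB //.
  by case: ifP => //; lia.
- rewrite (@canonE _ k.+1 (m + 1)) /= ?mulrDl ?mulVr // ?xE ?rmorphD //.
  by case: ifP => //; lia.
Qed.

Lemma canonN x : canon (- x) = game_opp (canon x).
Proof.
have [k [m [xE _]]] := dyadic_repr x.
have NxE : - x * 2 ^+ k = (- m)%:~R by rewrite mulNr xE rmorphN.
rewrite (canonE xE) (canonE NxE) {x xE NxE}.
elim: k m => [|k IH] m /=; first by case: m => [[|n]|n] //=; rewrite game_oppK.
have -> : (2 %| - m)%Z = (2 %| m)%Z by lia.
case: ifP => mE; first by rewrite -IH; congr canon_frac; lia.
by rewrite /= -!IH; do ![congr Game || congr [:: _] || congr canon_frac]; lia.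
Qed.

Lemma left_canon {x XL} : XL \in lefts (canon x) ->
  exists2 y, y < x & XL = canon y.
Proof.
have [k [m [xE red]]] := dyadic_repr x.
case: k red xE => [|k] red xE.
  move: xE; rewrite expr0 mulr1 => ->; case: m {red} => [[|n]|n].
  - by rewrite canon0.
  - rewrite (canon_nat_succ n) inE => /eqP ->; exists n%:R => //.
    by rewrite ltr_nat.
  - by rewrite NegzE rmorphN canonN (canon_nat_succ n).
case: red => // odd_m; rewrite (canon_odd xE odd_m) inE => /eqP ->.
exists (x - 2 ^- k.+1) => //; rewrite ltrBlDr ltrDl.
by rewrite invr_gt0 exprn_gt0.
Qed.

Lemma right_canon {x XR} : XR \in rights (canon x) ->
  exists2 y, x < y & XR = canon y.
Proof.
move=> XRin; have : game_opp XR \in lefts (canon (- x)).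
  by rewrite canonN lefts_opp map_f.
case/left_canon => y lty E; exists (- y); first by rewrite ltrNr.
by rewrite canonN -E game_oppK.
Qed.

(** The least common denominator of the entries, together with an entry that needs all of it. *)
Lemma dyadic_max_level {s : seq dyadic} : s != [::] ->
  exists (x : dyadic) k (m : int), [/\ x \in s, x * 2 ^+ k = m%:~R,
    k = 0%N \/ ~~ (2 %| m)%Z &
    forall y, y \in s -> exists n : int, y * 2 ^+ k = n%:~R].
Proof.
have mono (y : dyadic) k l (n : int) : (k <= l)%N -> y * 2 ^+ k = n%:~R ->
    exists n' : int, y * 2 ^+ l = n'%:~R.
  move=> /subnK <- E; exists (n * 2 ^+ (l - k)).
  by rewrite addnC exprD mulrA E rmorphM rmorphXn.
elim: s => // x s IH _; have [k [m [xE red]]] := dyadic_repr x.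
have [->|/IH [z [l [n [zs zE redz zmax]]]]] := eqVneq s [::].
  exists x, k, m; split=> //; first exact: mem_head.
  by move=> y; rewrite inE => /eqP ->; exists m.
have [lek|/ltnW lel] := leqP l k.
- exists x, k, m; split=> //; first exact: mem_head.
  move=> y; rewrite inE => /orP[/eqP->|/zmax[n' E]]; first by exists m.
  exact: mono lek E.
- exists z, l, n; split=> //; first by rewrite inE zs orbT.
  move=> y; rewrite inE => /orP[/eqP->|/zmax[n' E]]; last by exists n'.
  exact: mono lel xE.
Qed.

(** Lists of any length let one induction serve both the comparison of two numbers and additivity,
    where three summands occur. *)
Definition canon_sum (s : seq dyadic) : game :=
  foldr (fun x => game_add (canon x)) (Game [::] [::]) s.

Lemma left_canon_sum s1 x y s2 : canon y \in lefts (canon x) ->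
  canon_sum (s1 ++ y :: s2) \in lefts (canon_sum (s1 ++ x :: s2)).
Proof.
by elim: s1 => [|z s1 IH] yin /=; [apply: left_addl | apply/left_addr/IH].
Qed.

Lemma right_canon_sum s GR : GR \in rights (canon_sum s) ->
  exists2 s', GR = canon_sum s' & \sum_(x <- s) x < \sum_(x <- s') x.
Proof.
elim: s GR => [|x s IH] GR //=.
rewrite rights_add mem_cat => /orP[]/mapP[Y Yin ->].
- have [y lty ->] := right_canon Yin.
  by exists (y :: s); rewrite // !big_cons ltrD2r.
- have [s' -> lts] := IH _ Yin.
  by exists (x :: s'); rewrite // !big_cons ltrD2l.
Qed.

(* If 2^-k is the smallest unit occurring in [s], then the sum is a positive
   multiple of it, so Left can afford to move by 2^-k in a component attaining
   it. *)
Lemma canon_sum_move (s : seq dyadic) : 0 < \sum_(x <- s) x ->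
  exists s', canon_sum s' \in lefts (canon_sum s) /\ 0 <= \sum_(x <- s') x.
Proof.
move=> pos; have s0 : s != [::] by apply: contraTneq pos => ->; rewrite big_nil.
have [x [k [m [xs xE red smax]]]] := dyadic_max_level s0.
have [n nE] : exists n : int, (\sum_(x <- s) x) * 2 ^+ k = n%:~R.
  elim: s smax {pos s0 xs} => [|y s IH] smax; 
    first by exists 0; rewrite big_nil mul0r.
  have [n E] := smax y (mem_head _ _).
  have [|n' E'] := IH; first by move=> z zs; apply: smax; rewrite inE zs orbT.
  by exists (n + n'); rewrite big_cons mulrDl E E' rmorphD.
have p2 : 0 < 2 ^+ k :> dyadic by rewrite exprn_gt0.
have u2 : (2 : dyadic) ^+ k \is a GRing.unit by rewrite unitrX ?dyadic_two_unit.
have ge1 : 2 ^- k <= \sum_(x <- s) x.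
  rewrite -(ler_pM2r p2) mulVr // nE (_ : 1 = 1%:~R) // ler_int.
  by rewrite -gtz0_ge1 -(ltr_int dyadic) -nE mulr_gt0.
suff [x0 [x0s x0in]] : exists x0, x0 \in s /\
    canon (x0 - 2 ^- k) \in lefts (canon x0).
  move: ge1; case/splitPr: x0s => s1 s2; rewrite big_cat big_cons /= => ge1.
  exists (s1 ++ (x0 - 2 ^- k) :: s2); split; first exact: left_canon_sum.
  by rewrite big_cat big_cons /= [_ - _ + _]addrAC addrA subr_ge0.
case: k red xE smax {nE p2 u2 ge1} => [_ _ smax|k [] // odd_m xE _]; last first.
  by exists x; split=> //; rewrite (canon_odd xE odd_m) mem_head.
(* For [k = 0] all entries are integers and [x] may be nonpositive, hence without a Left option.
   Some entry is positive, and Left can lower it by 1. *)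
have /hasP[x0 x0s x0_gt0] : has (fun x => 0 < x) s.
  apply: contraLR pos; rewrite -all_predC -leNgt => /allP le0.
  rewrite big_seq; apply: sumr_le0 => z /le0 /=; rewrite -leNgt; exact.
exists x0; split=> //; have [n0] := smax _ x0s.
rewrite expr0 mulr1 invr1 => E; move: x0_gt0; rewrite E ltr0z.
case: n0 {E} => [[|n0]|n0] // _; rewrite (canon_nat_succ n0) inE.
by rewrite (_ : _ - 1 = n0%:R) // -pmulrn -natr1 addrK.
Qed.

(** Each move of Right strictly increases the sum, and from a positive sum Left can move to a
    nonnegative one, so Left keeps these invariants until Right is stuck. *)
Lemma canon_sum_wins (s : seq dyadic) :
  (0 <= \sum_(x <- s) x -> Lwins false (canon_sum s)) /\
  (0 < \sum_(x <- s) x -> Lwins true (canon_sum s)).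
Proof.
have [n] := ubnP (gsize (canon_sum s)); elim: n s => // n IH s ltn.
split=> [ge0|/canon_sum_move[s' [s'in ge0]]].
- rewrite LwinsF; apply/allP => GR /[dup] /gsize_right ltR.
  move=> /right_canon_sum[s' E lts].
  rewrite E in ltR *; apply: (IH _ (leq_trans ltR ltn)).2.
  exact: le_lt_trans ge0 lts.
- rewrite LwinsT; apply/hasP; exists (canon_sum s') => //.
  exact: (IH _ (leq_trans (gsize_left _ _ s'in) ltn)).1 ge0.
Qed.

Lemma canon_le x y : game_ge (canon x) (canon y) = (y <= x).
Proof.
have sum2 a b : canon_sum [:: a; b] = game_add (canon a) (canon b).
  by rewrite /= game_addG0.
have ge a b : b <= a -> game_ge (canon a) (canon b).
  rewrite /game_ge /game_sub -canonN -sum2 => le.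
  by apply: (canon_sum_wins _).1; rewrite !big_cons big_nil; lra.
have [|lt] := leP y x; first exact: ge.
rewrite -[LHS]negbK -LwinsT_sub /game_sub -canonN -sum2.
by apply/negbTE; rewrite negbK; apply: (canon_sum_wins _).2;
  rewrite !big_cons big_nil; lra.
Qed.

Lemma canonD x y : game_eq (game_add (canon x) (canon y)) (canon (x + y)).
Proof.
apply/andP; split; rewrite /game_ge /game_sub -?canonN.
- rewrite -game_addA -[canon (- _)]game_addG0.
  by apply: (canon_sum_wins [:: x; y; - (x + y)]).1;
    rewrite !big_cons big_nil; lra.
- rewrite game_oppD -!canonN -[canon (- y)]game_addG0.
  by apply: (canon_sum_wins [:: x + y; - x; - y]).1;
    rewrite !big_cons big_nil; lra.
Qed.

(** Add [x] to both sides of the comparison on the right; [canonD] identifies [(y - x) + x] with [y]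
    in value. *)
Lemma game_ge_add_canonr G x y :
  game_ge (game_add G (canon x)) (canon y) = game_ge G (canon (y - x)).
Proof.
have /andP[h1 h2] := canonD (y - x) x; rewrite subrK in h1 h2.
by rewrite -(game_ge_add2r G _ (canon x)); apply/idP/idP => h;
  apply: game_ge_trans h _.
Qed.

Lemma game_ge_canon_addr G x y :
  game_ge (canon y) (game_add G (canon x)) = game_ge (canon (y - x)) G.
Proof.
have /andP[h1 h2] := canonD (y - x) x; rewrite subrK in h1 h2.
by rewrite -(game_ge_add2r _ G (canon x)); apply/idP/idP => h;
  apply: game_ge_trans _ h.
Qed.

Lemma canon_inj : injective canon.
Proof.
move=> x y E; apply: le_anti.
by rewrite -!canon_le E game_ge_refl.
Qed.

Lemma equal_to_intP G : equal_to_integer G <->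
  exists n : int, game_ge G (canon n%:~R) /\ game_ge (canon n%:~R) G.
Proof. by split=> -[n]; exists n; apply/andP. Qed.

Lemma equal_to_integer_opp G :
  equal_to_integer (game_opp G) <-> equal_to_integer G.
Proof.
suff opp H : equal_to_integer H -> equal_to_integer (game_opp H).
  by split=> /opp //; rewrite game_oppK.
move=> /equal_to_intP[n [h1 h2]]; apply/equal_to_intP; exists (- n).
by rewrite mulrNz canonN !game_ge_opp.
Qed.

Lemma equal_to_integer_number G : equal_to_integer G -> equal_to_number G.
Proof. by move=> [n]; exists n%:~R. Qed.

(** * Simplest integer and number avoidance *)

Lemma left_canon_nat n XL : XL \in lefts (canon n%:R) ->
  exists2 k, n = k.+1 & XL = canon k%:R.
Proof.
case: n => [|n]; first by rewrite canon0.
by rewrite canon_nat_succ inE => /eqP ->; exists n.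
Qed.

Lemma rights_canon_nat n : rights (canon n%:R) = [::].
Proof. by case: n => [|n]; rewrite ?canon0 ?canon_nat_succ. Qed.

(** The simplest integer that fits is the value. For [m >= 0], lower [m] as long as it still fits:
    either 0 is reached, or some Left option is [>= n] while [n + 1] fits, and then [G] equals
    [n + 1]. Negative [m] reduce to this by negation. *)
Lemma integer_fits G (m : int) :
  (forall GL, GL \in lefts G -> ~~ game_ge GL (canon m%:~R)) ->
  (forall GR, GR \in rights G -> ~~ game_ge (canon m%:~R) GR) ->
  equal_to_integer G.
Proof.
have nat_case H n : (forall GL, GL \in lefts H -> ~~ game_ge GL (canon n%:R)) ->
    (forall GR, GR \in rights H -> ~~ game_ge (canon n%:R) GR) ->
    equal_to_integer H.
  elim: n => [|n IH] hL hR.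
    apply/equal_to_intP; exists 0.
    by split; apply/game_geP; split=> // X; rewrite canon0.
  have hR' GR : GR \in rights H -> ~~ game_ge (canon n%:R) GR.
    move=> /hR; apply: contra; apply: game_ge_trans.
    by rewrite canon_le ler_nat.
  have [/allP hL'|] :=
      boolP (all (fun GL => ~~ game_ge GL (canon n%:R)) (lefts H)).
    exact: IH.
  rewrite -has_predC => /hasP[GL0 GL0in /=]; rewrite negbK => ge0.
  apply/equal_to_intP; exists n.+1; rewrite -pmulrn.
  split; apply/game_geP; split=> //; last by rewrite rights_canon_nat.
  move=> X /left_canon_nat[k [<-] ->]; apply: contra (not_left_ge GL0in).
  exact: game_ge_trans.
case: (intP m) => [|n|n] hL hR; first exact: (nat_case _ 0).
  exact: (nat_case _ n.+1).
apply/equal_to_integer_opp; apply: (nat_case _ n.+1) => X.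
- rewrite lefts_opp => /mapP[Y /hR h ->]; move: h; apply: contra.
  by rewrite mulrNz canonN -game_ge_opp game_oppK.
- rewrite rights_opp => /mapP[Y /hL h ->]; move: h; apply: contra.
  by rewrite mulrNz canonN -game_ge_opp game_oppK.
Qed.

(** The game [- n] has no Left option, so only Right's moves in [G] matter, and each of them makes
    [G] smaller. *)
Lemma ge_canon_size G n : (gsize G <= n)%N -> game_ge G (canon (- n%:R)).
Proof.
elim/game_opt_ind: G n => G _ IH n le_n; apply/game_geP; split=> X; last first.
  by rewrite canonN lefts_opp rights_canon_nat.
move=> /[dup] Xin /gsize_right ltX; case: n le_n => [|n] le_n; first by lia.
have /(IH _ Xin) XN : (gsize X <= n)%N by lia.
apply/negP => /game_ge_trans/(_ XN).
by rewrite canon_le lerN2 ler_nat ltnn.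
Qed.

(** Without Left options the integer [- gsize G] fits, since every Right option is smaller in size
    and so lies above it. This keeps [maxd] off its default value. *)
Lemma lefts_nonint {G} : ~ equal_to_integer G -> lefts G != [::].
Proof.
move=> nG; apply: contra_notN nG => /eqP noL.
apply: (integer_fits _ (- (gsize G)%:Z)); rewrite ?noL // => GR.
move=> /gsize_right ltR; have := ge_canon_size GR _ (leqnn _).
rewrite mulrNz -pmulrn => ge; apply/negP => /game_ge_trans/(_ ge).
by rewrite canon_le lerN2 ler_nat leqNgt ltR.
Qed.

Lemma rights_nonint {G} : ~ equal_to_integer G -> rights G != [::].
Proof.
rewrite -equal_to_integer_opp => /lefts_nonint.
by rewrite lefts_opp; case: (rights G).
Qed.

(** Number avoidance is needed relative to all numbers, for stops, and relative to the integers, for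
    the walls at -1, where [G] may be a number that is not an integer. Closure under negation
    transfers the condition to Left options. *)
Definition option_closed (D : dyadic -> Prop) : Prop :=
  forall x, D x -> D (- x) /\
    forall XR, XR \in rights (canon x) -> exists2 y, D y & XR = canon y.

(** If the failure of [x >= G] is not due to a Left option of [G], it is due to a Right option [y]
    of [x] with [G >= y]. As [G] differs from [y], also [y >= G] fails, and induction gives a Left
    option above [y], hence above [x]. *)
Lemma number_avoidance_left {D G} : option_closed D ->
  (forall x, D x -> ~ game_eq G (canon x)) ->
  forall x, D x -> ~~ game_ge (canon x) G ->
  exists2 GL, GL \in lefts G & game_ge GL (canon x).
Proof.
move=> Dcl nG x; have [n] := ubnP (gsize (canon x)).
elim: n x => // n IH x ltn Dx.
rewrite game_geE negb_and -!has_predC => /orP[]/hasP[X Xin /=]; rewrite negbK;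
  last by exists X.
move=> GX; have [y Dy E] := (Dcl x Dx).2 _ Xin.
have [y' lty E'] := right_canon Xin.
rewrite -(canon_inj _ _ (etrans (esym E) E')) in lty.
have lts : (gsize (canon y) < n)%N.
  by rewrite -E; apply: leq_trans (gsize_right _ _ Xin) _.
have [|GL GLin geL] := IH y lts Dy.
  by apply/negP => yG; apply: (nG y Dy); rewrite /game_eq yG -E GX.
by exists GL; rewrite // (game_ge_trans geL) // canon_le ltW.
Qed.

Lemma number_avoidance_right {D G} : option_closed D ->
  (forall x, D x -> ~ game_eq G (canon x)) ->
  forall x, D x -> ~~ game_ge G (canon x) ->
  exists2 GR, GR \in rights G & game_ge (canon x) GR.
Proof.
move=> Dcl nG x Dx nge.
have [||||X] := @number_avoidance_left D (game_opp G) _ _ (- x).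
- exact: Dcl.
- move=> y /Dcl[DN _] h; apply: (nG (- y)) => //.
  by move: h; rewrite /game_eq canonN game_ge_oppl game_ge_oppr andbC.
- exact: (Dcl _ Dx).1.
- by rewrite canonN game_ge_opp.
rewrite lefts_opp canonN => /mapP[Y Yin ->]; rewrite game_ge_opp.
by exists Y.
Qed.

Lemma option_closed_true : option_closed (fun=> True).
Proof. by move=> x _; split=> // XR /right_canon[y _ ->]; exists y. Qed.

Lemma option_closed_int : option_closed (fun x => exists n : int, x = n%:~R).
Proof.
move=> _ [n ->]; split; first by exists (- n); rewrite rmorphN.
move=> XR; case: (intP n) => [|k|k].
- by rewrite canon0.
- by rewrite -pmulrn rights_canon_nat.
- rewrite mulrNz -pmulrn canonN canon_nat_succ inE => /eqP ->.
  exists (- k%:R); last by rewrite canonN.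
  by exists (- k%:Z); rewrite mulrNz -pmulrn.
Qed.

(** * Finite maxima and stops *)

Lemma maxdE {A : set dyadic} {x} : is_max A x -> maxd A = x.
Proof.
move=> [Ax ubx]; apply: xget_unique; first by split.
by move=> y [Ay uby]; apply: le_anti; rewrite ubx ?uby.
Qed.

Lemma mindE {A : set dyadic} {x} : is_min A x -> mind A = x.
Proof.
move=> [Ax lbx]; apply: xget_unique; first by split.
by move=> y [Ay lby]; apply: le_anti; rewrite lbx ?lby.
Qed.

Lemma seq_max_exists {T : eqType} (F : T -> dyadic) {s : seq T} : s != [::] ->
  exists2 i, i \in s & is_max [set` map F s] (F i).
Proof.
elim: s => // i s IH _; have [->|/IH[j js [_ ub]]] := eqVneq s [::].
  exists i; first exact: mem_head.
  by split=> [|x] /=; rewrite inE // => /eqP ->.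
have [le_ij|/ltW le_ji] := leP (F i) (F j).
- exists j; first by rewrite inE js orbT.
  split=> [|x] /=; first by rewrite inE map_f ?orbT.
  by rewrite inE => /orP[/eqP->|/ub].
- exists i; first exact: mem_head.
  split=> [|x] /=; first by rewrite inE eqxx.
  rewrite inE => /orP[/eqP->|/ub le_xj] //; exact: le_trans le_xj le_ji.
Qed.

Lemma seq_min_exists {T : eqType} (F : T -> dyadic) {s : seq T} : s != [::] ->
  exists2 i, i \in s & is_min [set` map F s] (F i).
Proof.
elim: s => // i s IH _; have [->|/IH[j js [_ lb]]] := eqVneq s [::].
  exists i; first exact: mem_head.
  by split=> [|x] /=; rewrite inE // => /eqP ->.
have [le_ji|/ltW le_ij] := leP (F j) (F i).
- exists j; first by rewrite inE js orbT.
  split=> [|x] /=; first by rewrite inE map_f ?orbT.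
  by rewrite inE => /orP[/eqP->|/lb].
- exists i; first exact: mem_head.
  split=> [|x] /=; first by rewrite inE eqxx.
  rewrite inE => /orP[/eqP->|/lb le_jx] //; exact: le_trans le_ij le_jx.
Qed.

Lemma maxd_attained {T : eqType} (F : T -> dyadic) {s : seq T} : s != [::] ->
  exists2 i, i \in s & maxd [set` map F s] = F i.
Proof. by move=> /(seq_max_exists F)[i is_ /maxdE ->]; exists i. Qed.

Lemma mind_attained {T : eqType} (F : T -> dyadic) {s : seq T} : s != [::] ->
  exists2 i, i \in s & mind [set` map F s] = F i.
Proof. by move=> /(seq_min_exists F)[i is_ /mindE ->]; exists i. Qed.

Lemma le_maxd {T : eqType} (F : T -> dyadic) {s : seq T} {i} :
  i \in s -> F i <= maxd [set` map F s].
Proof.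
move=> ins; have [|j js mx] := @seq_max_exists T F s; first by case: s ins.
by rewrite (maxdE mx); apply: mx.2; rewrite /= map_f.
Qed.

Lemma mind_le {T : eqType} (F : T -> dyadic) {s : seq T} {i} :
  i \in s -> mind [set` map F s] <= F i.
Proof.
move=> ins; have [|j js mn] := @seq_min_exists T F s; first by case: s ins.
by rewrite (mindE mn); apply: mn.2; rewrite /= map_f.
Qed.

Lemma dyadic_dense (x y : dyadic) : x < y -> exists z, x < z < y.
Proof.
move=> xy; have := dyadic_halfK (x + y); move: (_ / 2) => z zE.
by exists z; apply/andP; split; lra.
Qed.

Lemma stop_number b {G x} : game_eq G (canon x) -> stop b G = x.
Proof.
move=> Gx; have nG : equal_to_number G by exists x.
case: G Gx nG => Ls Rs Gx nG /=; case: pselect => // h; case: cid => y /= Gy.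
move: Gx Gy => /andP[Gx xG] /andP[Gy yG]; apply: le_anti.
by rewrite -!canon_le (game_ge_trans xG Gy) (game_ge_trans yG Gx).
Qed.

Lemma LstopE G : ~ equal_to_number G ->
  Lstop G = maxd [set` map Rstop (lefts G)].
Proof. by case: G => Ls Rs nG; rewrite /Lstop /=; case: pselect. Qed.

Lemma RstopE G : ~ equal_to_number G ->
  Rstop G = mind [set` map Lstop (rights G)].
Proof. by case: G => Ls Rs nG; rewrite /Rstop /=; case: pselect. Qed.

(** Number avoidance moves a comparison of [G] with a number to an option, where induction applies.
    At the stop itself nothing is claimed: there infinitesimals decide. *)
Lemma stop_cut G x :
  ((Lstop G < x -> game_ge (canon x) G) /\
   (x < Lstop G -> ~~ game_ge (canon x) G)) /\
  ((x < Rstop G -> game_ge G (canon x)) /\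
   (Rstop G < x -> ~~ game_ge G (canon x))).
Proof.
elim/game_opt_ind: G x => G IHL IHR x.
have [[y Gy]|nG] := pselect (equal_to_number G).
  rewrite /Lstop /Rstop !(stop_number _ Gy); case/andP: Gy => Gy yG.
  split; split=> lt.
  - by apply: game_ge_trans yG; rewrite canon_le ltW.
  - by apply/negP => /game_ge_trans/(_ Gy); rewrite canon_le leNgt lt.
  - by apply: game_ge_trans Gy _; rewrite canon_le ltW.
  - by apply/negP => /(game_ge_trans yG); rewrite canon_le leNgt lt.
have nI : ~ equal_to_integer G by move=> /equal_to_integer_number.
have avoid y : True -> ~ game_eq G (canon y).
  by move=> _ Gy; apply: nG; exists y.
rewrite LstopE // RstopE //; split; split=> lt.
- rewrite -[game_ge _ _]negbK; apply/negP.
  case/(number_avoidance_left option_closed_true avoid _ I) => GL GLin.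
  apply/negP; apply: ((IHL GL GLin x).2).2.
  exact: le_lt_trans (le_maxd Rstop GLin) lt.
- have [GL GLin E] := maxd_attained Rstop (lefts_nonint nI).
  rewrite {}E in lt; have ge := ((IHL GL GLin x).2).1 lt.
  by apply: contra (not_left_ge GLin); apply: game_ge_trans.
- rewrite -[game_ge _ _]negbK; apply/negP.
  case/(number_avoidance_right option_closed_true avoid _ I) => GR GRin.
  apply/negP; apply: ((IHR GR GRin x).1).2.
  exact: lt_le_trans lt (mind_le Lstop GRin).
- have [GR GRin E] := mind_attained Lstop (rights_nonint nI).
  rewrite {}E in lt; have ge := ((IHR GR GRin x).1).1 lt.
  apply: contra (not_ge_right GRin) => Gx; exact: game_ge_trans Gx ge.
Qed.

(** Density makes up for the boundary value left out in [stop_cut]. *)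
Lemma le_of_gt (a b : dyadic) : (forall x, a < x -> b <= x) -> b <= a.
Proof.
move=> h; rewrite leNgt; apply/negP => /dyadic_dense[x /andP[/h le lt]].
by move: lt; rewrite ltNge le.
Qed.

Lemma le_of_lt (a b : dyadic) : (forall x, x < a -> x <= b) -> a <= b.
Proof.
move=> h; rewrite leNgt; apply/negP => /dyadic_dense[x /andP[lt /h le]].
by move: lt; rewrite ltNge le.
Qed.

Lemma Lstop_le G x : game_ge (canon x) G -> Lstop G <= x.
Proof.
by move=> ge; rewrite leNgt; apply/negP => /(stop_cut G x).1.2; rewrite ge.
Qed.

Lemma le_Rstop G x : game_ge G (canon x) -> x <= Rstop G.
Proof.
by move=> ge; rewrite leNgt; apply/negP => /(stop_cut G x).2.2; rewrite ge.
Qed.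

Lemma le_Lstop G x : ~~ game_ge (canon x) G -> x <= Lstop G.
Proof. by apply: contraNT; rewrite -ltNge; apply: (stop_cut G x).1.1. Qed.

Lemma Rstop_le G x : ~~ game_ge G (canon x) -> Rstop G <= x.
Proof. by apply: contraNT; rewrite -ltNge; apply: (stop_cut G x).2.1. Qed.

(** A stop is determined by the numbers above the game, and translation shifts this cut by [y]. *)
Lemma Lstop_add G y : Lstop (game_add G (canon y)) = Lstop G + y.
Proof.
apply: le_anti; apply/andP; split.
- apply: le_of_gt => x; rewrite -ltrBrDr => /(stop_cut G _).1.1.
  by rewrite -game_ge_canon_addr => /Lstop_le.
- rewrite -lerBrDr; apply: le_of_gt => x; rewrite ltrBlDr.
  move=> /(stop_cut _ _).1.1; rewrite game_ge_canon_addr addrK; exact: Lstop_le.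
Qed.

Lemma Rstop_add G y : Rstop (game_add G (canon y)) = Rstop G + y.
Proof.
apply: le_anti; apply/andP; split.
- apply: le_of_lt => x /(stop_cut _ _).2.1.
  by rewrite game_ge_add_canonr => /le_Rstop; rewrite lerBlDr.
- rewrite -lerBrDr; apply: le_of_lt => x /(stop_cut G _).2.1 Gx.
  by rewrite lerBrDr; apply: le_Rstop; rewrite game_ge_add_canonr addrK.
Qed.

(** * Piecewise affine functions *)

(** Closure of the affine functions under continuous gluing. Nested joints need no ordering, so
    pointwise operations go by induction; sorted break points are produced only in
    [pl_trajectory]. *)
Inductive pl (A : seq dyadic) : (dyadic -> dyadic) -> Prop :=
| pl_affine a b of a \in A : pl A (fun x => a * x + b)
| pl_glue f g c of pl A f & pl A g & f c = g c :
    pl A (fun x => if x <= c then f x else g x).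

Lemma pl_ext A f g : f =1 g -> pl A f -> pl A g.
Proof. by move=> /funext ->. Qed.

(** Splitting along the joints of [f] and then of [g] leaves only pairs of affine pieces. *)
Lemma pl_map2 A B C (op : dyadic -> dyadic -> dyadic) f g :
  (forall a b a' b', a \in A -> a' \in B ->
     pl C (fun x => op (a * x + b) (a' * x + b'))) ->
  pl A f -> pl B g -> pl C (fun x => op (f x) (g x)).
Proof.
move=> op_affine Af; elim: Af g => [a b aA|f1 f2 c _ IH1 _ IH2 E] g Bg.
- elim: Bg => [a' b' a'B|g1 g2 c _ IH1 _ IH2 E]; first exact: op_affine.
  apply: pl_ext (pl_glue _ _ _ c IH1 IH2 _) => [x|]; first by case: leP.
  by rewrite E.
- apply: pl_ext (pl_glue _ _ _ c (IH1 g Bg) (IH2 g Bg) _) => [x|].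
    by case: leP.
  by rewrite E.
Qed.

Lemma pl_cst (A : seq dyadic) c : 0 \in A -> pl A (fun=> c).
Proof.
by move=> A0; apply: pl_ext (pl_affine A 0 c A0) => x; rewrite mul0r add0r.
Qed.

Lemma pl_sub A B C f g : (forall a b, a \in A -> b \in B -> a - b \in C) ->
  pl A f -> pl B g -> pl C (fun x => f x - g x).
Proof.
move=> ABC; apply: (pl_map2 _ _ _ (fun u v => u - v)) => a b a' b' aA a'B.
by apply: pl_ext (pl_affine _ (a - a') (b - b') (ABC _ _ aA a'B)) => x; ring.
Qed.

Lemma pl_opp A B f : (forall a, a \in A -> - a \in B) ->
  pl A f -> pl B (fun x => - f x).
Proof.
move=> AB Af; have C0 : pl [:: 0] (fun=> 0) by apply: pl_cst; rewrite inE.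
apply: pl_ext (pl_sub _ _ B _ _ _ C0 Af) => [x|a b]; first by rewrite sub0r.
by rewrite inE => /eqP -> bA; rewrite sub0r AB.
Qed.

Lemma pl_max f g : pl [:: 0; -1] f -> pl [:: 0; -1] g ->
  pl [:: 0; -1] (fun x => Order.max (f x) (g x)).
Proof.
have crossing b b' :
    pl [:: 0; -1] (fun x => Order.max (0 * x + b) ((-1) * x + b')).
  have sl a c : a \in [:: 0; -1] -> pl [:: 0; -1] (fun x => a * x + c).
    exact: pl_affine.
  (* The lines meet at [b' - b], a dyadic point because the slopes differ by 1; to its left the
     sloping line is the higher one. *)
  apply: pl_ext (pl_glue _ _ _ (b' - b) (sl (-1) b' _) (sl 0 b _) _) => [x|||];
    rewrite ?inE ?eqxx ?orbT //; last by ring.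
  by case: leP => [h|h]; [rewrite max_r | rewrite max_l]; lra.
apply: pl_map2 => a b a' b'; rewrite !inE.
case/orP=> /eqP-> /orP[]/eqP->.
- by apply: pl_ext (pl_cst _ (Order.max b b') (mem_head _ _)) => x;
    rewrite !mul0r !add0r.
- exact: crossing.
- by apply: pl_ext (crossing b' b) => x; rewrite maxC.
- apply: pl_ext (pl_affine _ (-1) (Order.max b b') _) => [x|].
    by rewrite addr_maxr.
  by rewrite !inE eqxx orbT.
Qed.

Lemma maxd_cons (T : eqType) (F : T -> dyadic) i s : s != [::] ->
  maxd [set` map F (i :: s)] = Order.max (F i) (maxd [set` map F s]).
Proof.
move=> s0; have [j js E] := maxd_attained F s0.
have [k] := @maxd_attained _ F (i :: s) isT; rewrite inE => ks Ek.
apply: le_anti; apply/andP; split.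
- rewrite Ek le_max; case/orP: ks => [/eqP->|/(le_maxd F) ->].
    by rewrite lexx.
  by rewrite orbT.
- by rewrite E ge_max !le_maxd // ?inE ?js ?eqxx ?orbT.
Qed.

Lemma mind_maxd (T : eqType) (F : T -> dyadic) s : s != [::] ->
  mind [set` map F s] = - maxd [set` map (fun i => - F i) s].
Proof.
move=> s0; have [i is_ E] := mind_attained F s0.
have [j js E'] := maxd_attained (fun i => - F i) s0.
apply: le_anti; apply/andP; split.
- by rewrite E' opprK mind_le.
- by rewrite E lerNl (le_maxd (fun i => - F i)).
Qed.

Lemma pl_maxd (T : eqType) (F : T -> dyadic -> dyadic) s : s != [::] ->
  (forall i, i \in s -> pl [:: 0; -1] (F i)) ->
  pl [:: 0; -1] (fun t => maxd [set` map (F^~ t) s]).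
Proof.
elim: s => // i s IH _ Fs; have Fi := Fs i (mem_head _ _).
have [s0|s0] := eqVneq s [::].
  apply: pl_ext Fi => t; have [j] := @maxd_attained _ (F^~ t) (i :: s) isT.
  by rewrite s0 inE => /eqP ->.
have {}IH : pl [:: 0; -1] (fun t => maxd [set` map (F^~ t) s]).
  by apply: IH => // j js; apply: Fs; rewrite inE js orbT.
by apply: pl_ext (pl_max _ _ Fi IH) => t; rewrite maxd_cons.
Qed.

Lemma pl_mind (T : eqType) (F : T -> dyadic -> dyadic) s : s != [::] ->
  (forall i, i \in s -> pl [:: 0; 1] (F i)) ->
  pl [:: 0; 1] (fun t => mind [set` map (F^~ t) s]).
Proof.
move=> s0 Fs; have NF i : i \in s -> pl [:: 0; -1] (fun t => - F i t).
  move=> /Fs; apply: pl_opp => a; rewrite !inE => /orP[]/eqP->.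
    by rewrite oppr0 eqxx.
  by rewrite eqxx orbT.
apply: pl_ext (pl_opp _ _ _ _ (pl_maxd _ _ _ s0 NF)) => [t|a].
  by rewrite mind_maxd.
rewrite !inE => /orP[]/eqP->; first by rewrite oppr0 eqxx.
by rewrite opprK eqxx orbT.
Qed.

(** * Monotonicity and least zeros of piecewise affine functions *)

Lemma pl_nonincreasing A f : (forall a, a \in A -> a <= 0) -> pl A f ->
  forall x y, x <= y -> f y <= f x.
Proof.
move=> A_le0 Af; elim: Af => [a b /A_le0 a_le0|{}f g c _ IHf _ IHg E] x y xy.
  by rewrite lerD2r ler_wnM2l.
case: (leP y c) => yc; case: (leP x c) => xc; first exact: IHf.
- by move: (lt_le_trans xc xy); rewrite ltNge yc.
- by apply: le_trans (IHf x c xc); rewrite E IHg // ltW.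
- exact: IHg.
Qed.

(** An affine piece of slope -1 or -2 vanishes at [b] or [b / 2], which is dyadic. A glued function
    is nonincreasing, so its sign at the joint tells which piece to search. *)
Lemma pl_least_zero f u v : pl [:: 0; -1; -2] f -> 0 < f u -> f v <= 0 ->
  exists2 tau, f tau = 0 & forall t, t < tau -> 0 < f t.
Proof.
have A_le0 (a : dyadic) : a \in [:: 0; -1; -2] -> a <= 0.
  by rewrite !inE => /or3P[] /eqP ->; lra.
move=> Af; elim: Af u v => [a b aA|{}f g c Af IHf Ag IHg E] u v.
  move: aA; rewrite !inE => /or3P[]/eqP-> fu fv.
  - by move: fu fv; rewrite !mul0r => fu /(lt_le_trans fu); rewrite ltxx.
  - by exists b => [|t t_lt]; lra.
  - by exists (b / 2) => [|t]; have := dyadic_halfK b; move: (b / 2) => h;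
      [lra | move=> hb t_lt; lra].
have monf := pl_nonincreasing _ _ A_le0 Af.
have mong := pl_nonincreasing _ _ A_le0 Ag.
move=> fu fv; have [fc|fc] := leP (f c) 0.
  have fu0 : 0 < f u.
    move: fu; case: (leP u c) => // /ltW/mong gu.
    by move=> /lt_le_trans/(_ gu); rewrite -E ltNge fc.
  have [tau tau0 pos] := IHf u c fu0 fc.
  have tauc : tau <= c by rewrite leNgt; apply/negP => /pos; rewrite ltNge fc.
  exists tau; first by rewrite tauc.
  by move=> t t_lt; rewrite (le_trans (ltW t_lt) tauc) pos.
have gv : g v <= 0.
  move: fv; case: (leP v c) => // /monf fcv; have := lt_le_trans fc fcv.
  by rewrite ltNge => /negbTE ->.
have gc : 0 < g c by rewrite -E.
have [tau tau0 pos] := IHg c v gc gv.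
have tauc : c < tau.
  rewrite ltNge; apply/negP => /mong; rewrite tau0 => /(lt_le_trans gc).
  by rewrite ltxx.
exists tau; first by rewrite leNgt tauc.
move=> t t_lt; case: (leP t c) => [/monf|_]; first exact: lt_le_trans.
exact: pos.
Qed.

(* [f] restricted to [[c, +oo)], prolonged to the left by any half line that
   joins up at [c]. *)
Definition tail_trajectory (A : seq dyadic) (c : dyadic)
    (f : dyadic -> dyadic) : Prop :=
  forall a0 b0, a0 \in A -> a0 * c + b0 = f c ->
  exists n a b j,
    [/\ trajectory_form (fun x => if x <= c then a0 * x + b0 else f x) n a b j,
        forall i, (i <= n.+1)%N -> a i \in A &
        [/\ a 0%N = a0, b 0%N = b0 & j 0%N = c]].

Lemma tail_trajectory_affine (A : seq dyadic) c f a b :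
  {subset A <= [:: -1; 0; 1]} -> a \in A ->
  (forall x, c <= x -> f x = a * x + b) -> tail_trajectory A c f.
Proof.
move=> subA aA fE a0 b0 a0A E.
exists 0%N, (fun i => if i is _.+1 then a else a0),
  (fun i => if i is _.+1 then b else b0), (fun=> c).
split=> //; last by case.
split=> //; first by case=> [|i] _; apply: subA.
- by case=> // _; rewrite E fE.
- split=> // x; first by move=> ->.
  rewrite le_eqVlt => /predU1P[<-|lt]; first by rewrite lexx E fE.
  by rewrite leNgt lt fE ?ltW.
Qed.

(** For the tail at [d], the line of the piece between [c] and [d] serves as left half line. It is
    then cut at [c], and the given half line is put before it, which shifts all indices by one. *)
Lemma tail_trajectory_cons A c d f a b :
  {subset A <= [:: -1; 0; 1]} -> a \in A -> c <= d ->
  (forall x, c <= x <= d -> f x = a * x + b) ->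
  tail_trajectory A d f -> tail_trajectory A c f.
Proof.
move=> subA aA cd fE tl a0 b0 a0A E0.
have fc : f c = a * c + b by rewrite fE // lexx.
have [|n [a' [b' [j [form a'A [a'0 b'0 j0]]]]]] := tl a b aA.
  by rewrite fE // cd lexx.
have [_ jmono jE [_ mid right]] := form.
exists n.+1, (fun i => if i is k.+1 then a' k else a0),
  (fun i => if i is k.+1 then b' k else b0),
  (fun i => if i is k.+1 then j k else c).
have j_ge i : (i <= n)%N -> d <= j i.
  elim: i => [|i IH] lei; first by rewrite j0.
  exact: le_trans (IH (ltnW lei)) (jmono i lei).
have f_gt x : d <= x -> (if x <= d then a * x + b else f x) = f x.
  by move=> dx; case: leP => // xd; rewrite fE // (le_trans cd dx).
have gE x : c <= x -> (if x <= c then a0 * x + b0 else f x) = f x.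
  by rewrite le_eqVlt => /predU1P[<-|lt]; [rewrite lexx | rewrite leNgt lt].
split=> //; last by case.
split=> //; first by case=> [|i] lti; apply: subA => //; exact: a'A.
- by case=> [|i] lti; [rewrite j0 | exact: jmono].
- by case=> [|i] lti; [rewrite a'0 b'0 E0 fc | exact: jE].
- split.
  + by move=> x ->.
  + case=> [|i] x lti /andP[jx xj].
      by rewrite gE // a'0 b'0 fE // jx -j0.
    have dx : d <= x by apply: le_trans jx; apply: j_ge; apply: ltnW.
    by rewrite gE ?(le_trans cd) // -f_gt // (mid i) ?jx.
  + move=> x jx; have dx : d <= x by apply: le_trans jx; apply: j_ge.
    by rewrite gE ?(le_trans cd) // -f_gt // right.
Qed.

(** Pieces are put in front of the tail from right to left. At a joint [e] strictly between [c] and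
    [d] the right branch is treated on [[e, d]], then the left one on [[c, e]]; otherwise one branch
    covers the interval. So the break points come out sorted. *)
Lemma pl_tail_trajectory A f c d h :
  {subset A <= [:: -1; 0; 1]} -> pl A f -> c <= d ->
  (forall x, c <= x <= d -> h x = f x) ->
  tail_trajectory A d h -> tail_trajectory A c h.
Proof.
move=> subA Af; elim: Af c d => [a b aA|{}f g e _ IHf _ IHg E] c d cd hE.
  exact: tail_trajectory_cons subA aA cd hE.
have [de|ed] := leP d e.
  apply: IHf => // x /[dup] xcd /andP[_ xd].
  by rewrite hE // (le_trans xd de).
have hg x : e <= x -> c <= x <= d -> h x = g x.
  move=> ex /hE ->; case: leP => // xe.
  by have -> : x = e by [apply: le_anti; rewrite xe ex].
have [ec|ce] := leP e c.
  apply: IHg => // x /[dup] xcd /andP[cx _].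
  exact: hg (le_trans ec cx) xcd.
move=> tl; apply: (IHf c e) (ltW ce) _ _.
  move=> x /andP[cx xe]; rewrite hE ?xe // cx.
  exact: le_trans xe (ltW ed).
apply: (IHg e d) (ltW ed) _ tl => x /andP[ex xd].
by apply: hg; rewrite // xd (le_trans (ltW ce)).
Qed.

Lemma pl_ends A f : pl A f ->
  (exists c a b, a \in A /\ forall x, x <= c -> f x = a * x + b) /\
  (exists d a b, a \in A /\ forall x, d <= x -> f x = a * x + b).
Proof.
elim=> [a b aA|{}f g e _ [[c [a [b [aA fE]]]] _]
  _ [_ [d [a' [b' [a'A gE]]]]] E].
  by split; exists 0, a, b.
split.
- exists (Order.min c e), a, b; split=> // x; rewrite le_min => /andP[xc xe].
  by rewrite xe fE.
- exists (Order.max d e), a', b'; split=> // x; rewrite ge_max => /andP[dx ex].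
  rewrite -gE //; case: leP => // xe.
  by have -> : x = e by [apply: le_anti; rewrite xe ex].
Qed.

Lemma pl_trajectory A f : {subset A <= [:: -1; 0; 1]} -> pl A f ->
  diadic_trajectory_slopes A f.
Proof.
move=> subA Af.
have [[c [a0 [b0 [a0A lE]]]] [d [a [b [aA rE]]]]] := pl_ends _ _ Af.
(* The points [c] and [d] from [pl_ends] come in no particular order, hence the maximum. *)
have tl : tail_trajectory A (Order.max c d) f.
  apply: tail_trajectory_affine subA aA _ => x; rewrite ge_max => /andP[_].
  exact: rE.
have {}tl : tail_trajectory A c f.
  by apply: (pl_tail_trajectory _ _ _ _ _ subA Af) tl; rewrite // le_max lexx.
have [|n [a' [b' [j [form slopes _]]]]] := tl a0 b0 a0A; first by rewrite lE.
exists n, a', b', j; split=> //.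
rewrite (_ : f = fun x => if x <= c then a0 * x + b0 else f x) //.
by apply/funext => x; case: leP => // /lE.
Qed.

(** Comparing the last piece at two points one unit apart shows that its slope is 0. *)
Lemma trajectory_mast A f c N : diadic_trajectory_slopes A f ->
  (forall x, N <= x -> f x = c) -> mast_value f c.
Proof.
move=> [n [a [b [j [form _]]]]] fc; exists n, a, b, j.
have [_ _ _ [_ _ right]] := form; pose x := Order.max N (j n).
have [Nx jx] : N <= x /\ j n <= x by rewrite !le_max !lexx orbT.
have := right x jx; have := right (x + 1) (le_trans jx _).
rewrite !fc ?(le_trans Nx) ?lerDl ?ler01 // => /(_ isT) E1 E2.
have a0 : a n.+1 = 0.
  by move: E1 E2; rewrite mulrDr mulr1; move: (_ * x) => y; lra.
by split=> //; move: E2; rewrite a0 mul0r add0r.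
Qed.

(** * Thermographs *)

Lemma dyadic_floor (x : dyadic) : exists m : int, m%:~R <= x < m%:~R + 1.
Proof.
have valz (n : int) : dyval n%:~R = n%:~R by exact: (rmorph_int val).
have := floor_itv (dyval x); set m := Num.floor _ => /andP[mx xm].
exists m; rewrite -(intrD _ m 1); apply/andP; split.
- by change (dyval m%:~R <= dyval x); rewrite valz.
- by change (dyval x < dyval (m + 1)%:~R); rewrite valz.
Qed.

Lemma seq_uniform_bound (T : eqType) (P : T -> dyadic -> Prop) (s : seq T) :
  (forall i x y, x <= y -> P i x -> P i y) ->
  (forall i, i \in s -> exists x, P i x) ->
  exists x, forall i, i \in s -> P i x.
Proof.
move=> up; elim: s => [|i s IH] ex; first by exists 0.
have [x Pix] := ex i (mem_head _ _).
have [|y Py] := IH; first by move=> j js; apply: ex; rewrite inE js orbT.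
exists (Order.max x y) => j; rewrite inE => /predU1P[->|/Py].
  by apply: up Pix; rewrite le_max lexx.
by apply: up; rewrite le_max lexx orbT.
Qed.

Lemma thermo_intE G : equal_to_integer G -> exists n : int,
  [/\ game_eq G (canon n%:~R), forall t, lambda t G = n%:~R,
      forall t, rho t G = n%:~R & forall t, cooled t G = canon n%:~R].
Proof.
case: G => Ls Rs; rewrite /lambda /rho /cooled /= => iG.
by case: pselect => // h; case: cid => n Gn /=; exists n.
Qed.

(** The strict inequality before [tau] says more than minimality; it is what rules out numberish
    cooled games there. *)
Definition is_temperature (G : game) (tau : dyadic) : Prop :=
  [/\ -1 < tau, lambda_tilde tau G = rho_tilde tau G &
      forall t, t < tau -> rho_tilde t G < lambda_tilde t G].

Lemma temperature_balance G tau : is_temperature G tau ->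
  is_min (balance_set G) tau.
Proof.
move=> [_ E lt]; split=> // t /= Et; rewrite leNgt; apply/negP => /lt.
by rewrite Et ltxx.
Qed.

Lemma thermo_temperatureE {G tau} : ~ equal_to_integer G ->
  is_temperature G tau ->
  let x := lambda_tilde tau G in
  [/\ temp G = Some tau,
      forall t, lambda t G = if t <= tau then lambda_tilde t G else x,
      forall t, rho t G = if t <= tau then rho_tilde t G else x &
      forall t, cooled t G = if t <= tau then cooled_tilde t G else canon x].
Proof.
move=> nG /temperature_balance/mindE E.
by have := thermo_nonintE nG; rewrite /= E.
Qed.

(* The fourth clause compares the thermograph at temperature -1 with integers;
   it forces the two walls to cross strictly above -1. *)
Definition regular (G : game) : Prop :=
  [/\ pl [:: 0; -1] (lambda^~ G), pl [:: 0; 1] (rho^~ G),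
      exists N c, forall t, N <= t -> lambda t G = c /\ rho t G = c,
      forall m : int,
        ((game_ge G (canon m%:~R) -> m%:~R <= rho (-1) G) /\
         (~~ game_ge (canon m%:~R) G -> m%:~R + 1 <= lambda (-1) G)) /\
        ((game_ge (canon m%:~R) G -> lambda (-1) G <= m%:~R) /\
         (~~ game_ge G (canon m%:~R) -> rho (-1) G <= m%:~R - 1))
    & ~ equal_to_integer G -> exists tau, is_temperature G tau].

Lemma regular_int G : equal_to_integer G -> regular G.
Proof.
move=> iG; have [n [/andP[Gn nG] lE rE _]] := thermo_intE _ iG.
split=> //.
- by apply: pl_ext (pl_cst _ n%:~R _) => [t|]; rewrite ?lE ?mem_head.
- by apply: pl_ext (pl_cst _ n%:~R _) => [t|]; rewrite ?rE ?mem_head.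
- by exists 0, n%:~R => t _; rewrite lE rE.
have int1 (k l : int) : k < l -> k%:~R + 1 <= l%:~R :> dyadic.
  by move=> kl; rewrite -(intrD _ k 1) ler_int; lia.
move=> m; rewrite lE rE; do 2 split.
- by move=> /(game_ge_trans nG); rewrite canon_le.
- move=> h; apply: int1; rewrite -(ltr_int dyadic) ltNge -canon_le.
  by apply: contra h => mn; apply: game_ge_trans mn nG.
- by move=> /game_ge_trans/(_ Gn); rewrite canon_le.
- move=> h; rewrite lerBrDr; apply: int1; rewrite -(ltr_int dyadic) ltNge.
  by rewrite -canon_le; apply: contra h => nm; apply: game_ge_trans Gn nm.
Qed.

Lemma le_lambda_tilde t {G GL} : GL \in lefts G ->
  rho t GL - t <= lambda_tilde t G.
Proof. exact: (le_maxd (fun GL => rho t GL - t)). Qed.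

Lemma rho_tilde_le t {G GR} : GR \in rights G ->
  rho_tilde t G <= lambda t GR + t.
Proof. exact: (mind_le (fun GR => lambda t GR + t)). Qed.

Lemma lambda_tilde_attained t {G} : ~ equal_to_integer G ->
  exists2 GL, GL \in lefts G & lambda_tilde t G = rho t GL - t.
Proof.
by move=> /lefts_nonint; apply: (maxd_attained (fun GL => rho t GL - t)).
Qed.

Lemma rho_tilde_attained t {G} : ~ equal_to_integer G ->
  exists2 GR, GR \in rights G & rho_tilde t G = lambda t GR + t.
Proof.
by move=> /rights_nonint; apply: (mind_attained (fun GR => lambda t GR + t)).
Qed.

Lemma pl_lambda_tilde G : ~ equal_to_integer G ->
  (forall GL, GL \in lefts G -> regular GL) ->
  pl [:: 0; -1] (lambda_tilde^~ G).
Proof.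
move=> nG regL; apply: (pl_maxd _ (fun GL t => rho t GL - t)).
  exact: lefts_nonint.
move=> GL /regL[_ plr _ _ _].
have plid : pl [:: 1] (fun t => 1 * t + 0) by apply: pl_affine; rewrite inE.
apply: pl_ext (pl_sub _ _ _ _ _ _ plr plid) => [t|a b].
  by rewrite mul1r addr0.
by rewrite !inE => /orP[]/eqP-> /eqP->; rewrite ?sub0r ?subrr eqxx ?orbT.
Qed.

Lemma pl_rho_tilde G : ~ equal_to_integer G ->
  (forall GR, GR \in rights G -> regular GR) ->
  pl [:: 0; 1] (rho_tilde^~ G).
Proof.
move=> nG regR; apply: (pl_mind _ (fun GR t => lambda t GR + t)).
  exact: rights_nonint.
move=> GR /regR[pll _ _ _ _].
have plid : pl [:: -1] (fun t => -1 * t + 0) by apply: pl_affine; rewrite inE.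
apply: pl_ext (pl_sub _ _ _ _ _ _ pll plid) => [t|a b].
  by rewrite mulN1r addr0 opprK.
by rewrite !inE => /orP[]/eqP-> /eqP->;
  rewrite opprK ?addNr ?add0r eqxx ?orbT.
Qed.

Lemma lambda_nonincreasing {G} : regular G ->
  forall s t, s <= t -> lambda t G <= lambda s G.
Proof.
case=> pll _ _ _ _; apply: pl_nonincreasing pll => a.
by rewrite !inE => /orP[]/eqP->; rewrite ?oppr_le0 ?ler01.
Qed.

Lemma rho_nondecreasing {G} : regular G ->
  forall s t, s <= t -> rho s G <= rho t G.
Proof.
case=> _ plr _ _ _ s t st; rewrite -lerN2.
apply: (pl_nonincreasing [:: 0; -1] _ _ (pl_opp _ _ _ _ plr)) st => a.
  by rewrite !inE => /orP[]/eqP->; rewrite ?oppr_le0 ?ler01.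
by rewrite !inE => /orP[]/eqP->; rewrite ?oppr0 eqxx ?orbT.
Qed.

(** The walls are monotone in opposite directions and end in the same mast, whose value therefore
    separates them. *)
Lemma walls_bounded G : regular G ->
  exists c, forall t, c <= lambda t G /\ rho t G <= c.
Proof.
move=> regG; have [_ _ [N [c E]] _ _] := regG; exists c => t.
have Nm : N <= Order.max N t by rewrite le_max lexx.
have tm : t <= Order.max N t by rewrite le_max lexx orbT.
have [<- Er] := E _ Nm; split; first exact: lambda_nonincreasing.
by rewrite -Er; apply: rho_nondecreasing.
Qed.

Lemma walls_cross G : ~ equal_to_integer G ->
  (forall GL, GL \in lefts G -> regular GL) ->
  (forall GR, GR \in rights G -> regular GR) ->
  exists v, lambda_tilde v G <= rho_tilde v G.
Proof.
move=> nG regL regR.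
have [||b bP] :=
    @seq_uniform_bound _ (fun H b => forall t, rho t H <= b) (lefts G).
- by move=> H x y xy Hx t; apply: le_trans (Hx t) xy.
- by move=> H /regL/walls_bounded[c cP]; exists c => t; case: (cP t).
have [||c cP] :=
    @seq_uniform_bound _ (fun H c => forall t, - c <= lambda t H) (rights G).
- by move=> H x y xy Hx t; apply: le_trans (Hx t); rewrite lerN2.
- move=> H /regR/walls_bounded[c cP]; exists (- c) => t.
  by rewrite opprK; case: (cP t).
(* At this [v] the left wall is at most [b - v <= 0] and the right wall at least [v - c >= 0]. *)
exists (Order.max b c); set v := Order.max b c.
have [bv cv] : b <= v /\ c <= v by rewrite !le_max !lexx orbT.
have [GL GLin ->] := lambda_tilde_attained v nG.
have [GR GRin ->] := rho_tilde_attained v nG.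
have := bP _ GLin v; have := cP _ GRin v.
by move: v (rho _ _) (lambda _ _) bv cv => v r l; lra.
Qed.

(** Otherwise the floor [m] of the left wall fits: a Left option [>= m] would push that wall up to
    [m + 1], and a Right option [<= m] would pull the right wall down to [m - 1], below the left
    one. *)
Lemma walls_at_minus1 G : ~ equal_to_integer G ->
  (forall GL, GL \in lefts G -> regular GL) ->
  (forall GR, GR \in rights G -> regular GR) ->
  rho_tilde (-1) G < lambda_tilde (-1) G.
Proof.
have leftF (r l z : dyadic) : z <= r -> l < z + 1 -> r - -1 <= l -> False.
  by lra.
have rightF (r l l' z : dyadic) :
    r <= z -> z <= l -> l <= l' -> l' <= r + -1 -> False by lra.
move=> nG regL regR; rewrite ltNge; apply: contra_notN nG => le_lr.
have [m /andP[mx xm]] := dyadic_floor (lambda_tilde (-1) G).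
apply: (integer_fits _ m) => X Xin; apply/negP => ge.
- have [_ _ _ /(_ m)[[/(_ ge) le_m _] _] _] := regL _ Xin.
  exact: leftF le_m xm (le_lambda_tilde (-1) Xin).
- have [_ _ _ /(_ m)[_ [/(_ ge) le_m _]] _] := regR _ Xin.
  exact: rightF le_m mx le_lr (rho_tilde_le (-1) Xin).
Qed.

Lemma temperature_exists G : ~ equal_to_integer G ->
  (forall GL, GL \in lefts G -> regular GL) ->
  (forall GR, GR \in rights G -> regular GR) ->
  exists tau, is_temperature G tau.
Proof.
move=> nG regL regR.
have gap1 := walls_at_minus1 _ nG regL regR.
have [v cross] := walls_cross _ nG regL regR.
have plf : pl [:: 0; -1; -2] (fun t => lambda_tilde t G - rho_tilde t G).
  apply: pl_sub (pl_lambda_tilde _ nG regL) (pl_rho_tilde _ nG regR) => a b.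
  have E2 : -1 - 1 = -2 :> dyadic by ring.
  by rewrite !inE => /orP[]/eqP-> /orP[]/eqP->;
    rewrite ?E2 ?subr0 ?sub0r eqxx ?orbT.
have [||tau tau0 pos] := pl_least_zero _ (-1) v plf.
- by rewrite subr_gt0.
- by rewrite subr_le0.
exists tau; split; last by move=> t /pos; rewrite subr_gt0.
(* The gap is nonincreasing and positive at -1, so it cannot vanish at or before -1. *)
- rewrite ltNge; apply/negP => tau1.
  have := pl_nonincreasing _ _ _ plf _ _ tau1; rewrite tau0 subr_le0.
  rewrite leNgt gap1 => /(_ _)/negP; apply=> // a.
  by rewrite !inE => /or3P[]/eqP->; rewrite ?oppr_le0 ?ler0n.
- by apply/eqP; rewrite -subr_eq0 tau0.
Qed.

Lemma regular_nonint G : ~ equal_to_integer G ->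
  (forall GL, GL \in lefts G -> regular GL) ->
  (forall GR, GR \in rights G -> regular GR) -> regular G.
Proof.
move=> nG regL regR; have [tau tauG] := temperature_exists _ nG regL regR.
have [tau1 E gap] := tauG; have [_ lE rE _] := thermo_temperatureE nG tauG.
split.
- have plc : pl [:: 0; -1] (fun=> lambda_tilde tau G).
    by apply: pl_cst; rewrite mem_head.
  have := pl_lambda_tilde _ nG regL.
  by move=> /(pl_glue _ _ _ tau)/(_ plc erefl); apply: pl_ext => t.
- have plc : pl [:: 0; 1] (fun=> lambda_tilde tau G).
    by apply: pl_cst; rewrite mem_head.
  have := pl_rho_tilde _ nG regR.
  by move=> /(pl_glue _ _ _ tau)/(_ plc (esym E)); apply: pl_ext => t.
- exists (tau + 1), (lambda_tilde tau G) => t tau_lt.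
  have lt : tau < t by apply: lt_le_trans tau_lt; rewrite ltrDl.
  by rewrite lE rE leNgt lt.
- have nGm x : (exists n : int, x = n%:~R) -> ~ game_eq G (canon x).
    by move=> [n ->] Gn; apply: nG; exists n.
  move=> m; have mint : exists n : int, m%:~R = n%:~R :> dyadic by exists m.
  (* As [-1 < tau], these are the untruncated walls. Passing to options shifts by 1, which turns
     bounds from a comparison into bounds from the failure of the reverse one. Two cases unfold
     [>=]; the other two use number avoidance relative to integers. *)
  rewrite lE rE (ltW tau1); do 2 split.
  + move=> /game_geP[hR _]; have [GR GRin ->] := rho_tilde_attained (-1) nG.
    have [_ _ _ /(_ m)[[_ /(_ (hR _ GRin)) le_m] _] _] := regR _ GRin.
    by rewrite lerBrDr.
  + case/(number_avoidance_left option_closed_int nGm _ mint) => GL GLin ge.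
    have [_ _ _ /(_ m)[[/(_ ge) le_m _] _] _] := regL _ GLin.
    by apply: le_trans (le_lambda_tilde (-1) GLin); rewrite opprK lerD2r.
  + move=> /game_geP[_ hL]; have [GL GLin ->] := lambda_tilde_attained (-1) nG.
    have [_ _ _ /(_ m)[_ [_ /(_ (hL _ GLin)) le_m]] _] := regL _ GLin.
    by rewrite opprK -lerBrDr.
  + case/(number_avoidance_right option_closed_int nGm _ mint) => GR GRin ge.
    have [_ _ _ /(_ m)[_ [/(_ ge) le_m _]] _] := regR _ GRin.
    by apply: le_trans (rho_tilde_le (-1) GRin) _; rewrite lerD2r.
- by exists tau.
Qed.

Lemma game_regular G : regular G.
Proof.
elim/game_opt_ind: G => G regL regR.
by have [/regular_int|/regular_nonint] := pselect (equal_to_integer G); auto.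
Qed.

(** * Stops of cooled games and numberishness *)

Lemma Rstop_sub G y : Rstop (game_sub G (canon y)) = Rstop G - y.
Proof. by rewrite /game_sub -canonN Rstop_add. Qed.

(** If the cooled game is not a number, its stops are computed from its options. If it equals [y],
    the options only give [lambda_tilde <= y <= rho_tilde], and the hypothesis on the walls forces
    equality. *)
Lemma cooled_tilde_stops G t : ~ equal_to_integer G ->
  (forall GL, GL \in lefts G -> Rstop (cooled t GL) = rho t GL) ->
  (forall GR, GR \in rights G -> Lstop (cooled t GR) = lambda t GR) ->
  rho_tilde t G <= lambda_tilde t G ->
  Lstop (cooled_tilde t G) = lambda_tilde t G /\
  Rstop (cooled_tilde t G) = rho_tilde t G.
Proof.
move=> nG stL stR le_rl.
have [[y ctE]|nct] := pselect (equal_to_number (cooled_tilde t G)).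
  rewrite /Lstop /Rstop !(stop_number _ ctE); case/andP: ctE => cty yct.
  have le_l : lambda_tilde t G <= y.
    have [GL GLin ->] := lambda_tilde_attained t nG.
    rewrite -stL // -Rstop_sub; apply: Rstop_le.
    have : game_sub (cooled t GL) (canon t) \in lefts (cooled_tilde t G).
      exact: (map_f (fun GL => game_sub (cooled t GL) (canon t))).
    by move/not_left_ge; apply: contra => /game_ge_trans; apply.
  have le_r : y <= rho_tilde t G.
    have [GR GRin ->] := rho_tilde_attained t nG.
    rewrite -stR // -Lstop_add; apply: le_Lstop.
    have : game_add (cooled t GR) (canon t) \in rights (cooled_tilde t G).
      exact: (map_f (fun GR => game_add (cooled t GR) (canon t))).
    by move/not_ge_right; apply: contra; apply: game_ge_trans.
  by split; apply: le_anti;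
    rewrite ?le_l ?le_r ?(le_trans le_rl) ?(le_trans le_r).
rewrite LstopE // RstopE //= -!map_comp; split.
- have /eq_in_map -> // : {in lefts G, Rstop \o
      (fun GL => game_sub (cooled t GL) (canon t)) =1 fun GL => rho t GL - t}.
  by move=> GL GLin /=; rewrite Rstop_sub stL.
- have /eq_in_map -> // : {in rights G,
      Lstop \o (fun GR => game_add (cooled t GR) (canon t)) =1
      fun GR => lambda t GR + t}.
  by move=> GR GRin /=; rewrite Lstop_add stR.
Qed.

Lemma cooled_stops G t :
  Lstop (cooled t G) = lambda t G /\ Rstop (cooled t G) = rho t G.
Proof.
elim/game_opt_ind: G => G IHL IHR.
have stopc x : Lstop (canon x) = x /\ Rstop (canon x) = x.
  by split; apply: stop_number; rewrite /game_eq game_ge_refl.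
have [iG|nG] := pselect (equal_to_integer G).
  by have [n [_ -> -> ->]] := thermo_intE _ iG.
have [_ _ _ _ /(_ nG)[tau tauG]] := game_regular G.
have [_ -> -> ->] := thermo_temperatureE nG tauG; have [_ E gap] := tauG.
case: leP => // t_le; apply: cooled_tilde_stops nG _ _ _.
- by move=> GL /IHL[].
- by move=> GR /IHR[].
- by move: t_le; rewrite le_eqVlt => /predU1P[->|/gap/ltW //]; rewrite E.
Qed.

(** Numbers above [x] bound [G] from above and numbers below [x] bound it from below, so by density
    [x] separates the stops. *)
Lemma numberish_stops G : numberish G -> Lstop G <= Rstop G.
Proof.
move=> [x xG]; apply: (@le_trans _ _ x).
- apply: le_of_gt => y; rewrite -subr_gt0 => /xG[_ /andP[]].
  by rewrite /game_sub -canonN game_ge_canon_addr opprK subrK => /Lstop_le.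
- apply: le_of_lt => y; rewrite -subr_gt0 => /xG[/andP[]].
  rewrite /game_sub -!canonN game_ge_add_canonr opprK opprB subrK.
  by move=> /le_Rstop.
Qed.

(** The common stop is the required number: the four comparisons are made at distance [e] from it,
    where [stop_cut] decides. *)
Lemma stops_numberish G : Lstop G = Rstop G -> numberish G.
Proof.
move=> E; exists (Lstop G) => e e_gt0; rewrite /game_gt /game_sub -!canonN.
rewrite !game_ge_add_canonr !game_ge_canon_addr opprK.
have ltL : Lstop G < e + Lstop G by rewrite ltrDr.
have gtL : - e + Lstop G < Lstop G by rewrite gtrDr oppr_lt0.
have [[L1 _] [_ R2]] := stop_cut G (e + Lstop G).
have [[_ L2] [R1 _]] := stop_cut G (- e + Lstop G).
by rewrite L1 // R1 -?E // L2 // R2 -?E.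
Qed.

Theorem theorem4 (G : game) :
  [/\ (* 1 *) ~ equal_to_integer G ->
        [/\ forall t : dyadic, exists x, is_max (lambda_tilde_set t G) x,
            forall t : dyadic, exists x, is_min (rho_tilde_set t G) x,
            exists tau, is_min (balance_set G) tau
          & exists2 tau, temp G = Some tau & -1 < tau],
      (* 2 *) diadic_trajectory_slopes [:: 0; -1] (fun t => lambda t G),
      (* 3 *) diadic_trajectory_slopes [:: 0; 1] (fun t => rho t G),
      (* 4 *) exists c : dyadic,
        mast_value (fun t => lambda t G) c /\ mast_value (fun t => rho t G) c
    & (* 5 *) (forall t : dyadic,
        Lstop (cooled t G) = lambda t G /\ Rstop (cooled t G) = rho t G) /\
      (* 6 *) (~ equal_to_integer G -> forall t : dyadic, -1 < t ->
        forall tau : dyadic, temp G = Some tau ->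
        [/\ t < tau -> ~ numberish (cooled t G),
            t = tau -> numberish (cooled t G)
          & tau < t -> equal_to_number (cooled t G)])].
Proof.
have [pll plr [N [c mast]] _ tempG] := game_regular G.
have trl : diadic_trajectory_slopes [:: 0; -1] (fun t => lambda t G).
  by apply: pl_trajectory pll => a; rewrite !inE => /orP[]/eqP->;
    rewrite eqxx ?orbT.
have trr : diadic_trajectory_slopes [:: 0; 1] (fun t => rho t G).
  by apply: pl_trajectory plr => a; rewrite !inE => /orP[]/eqP->;
    rewrite eqxx ?orbT.
split=> //.
- move=> nG; have [tau tauG] := tempG nG.
  split.
  + move=> t; have [GL _ mx] :=
      seq_max_exists (fun GL => rho t GL - t) (lefts_nonint nG).
    by exists (rho t GL - t).
  + move=> t; have [GR _ mn] :=
      seq_min_exists (fun GR => lambda t GR + t) (rights_nonint nG).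
    by exists (lambda t GR + t).
  + by exists tau; apply: temperature_balance.
  + by exists tau; [case: (thermo_temperatureE nG tauG) | case: tauG].
- exists c; split.
  + by apply: trajectory_mast trl _ => t /mast[].
  + by apply: trajectory_mast trr _ => t /mast[].
split=> [t|nG t _ tau]; first exact: cooled_stops.
have [tau' tauG] := tempG nG; have [-> lE rE cE] := thermo_temperatureE nG tauG.
have [_ E gap] := tauG => -[<-].
have [stL stR] := cooled_stops G t.
split.
(* Before the temperature the left wall lies strictly above the right one, against the order of the
   stops of a numberish game. *)
- move=> lt /numberish_stops; rewrite stL stR lE rE (ltW lt).
  by rewrite leNgt gap.
- by move=> t_eq; apply: stops_numberish; rewrite stL stR lE rE t_eq lexx.
- by rewrite cE ltNge => /negbTE ->; exists (lambda_tilde tau' G);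
    rewrite /game_eq game_ge_refl.
Qed.
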